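(* Let $(\theta_k)_{k=1}^\infty$ and $(\theta'_k)_{k=1}^\infty$ be non-increasing sequences in $(0,1)$ converging to $0$, and let $X=T[(\mathcal{A}_k,\theta_k)_{k=1}^\infty]$ and $X'=T[(\mathcal{A}_k,\theta'_k)_{k=1}^\infty]$ be such that $\ell_1$ is finitely block represented in every block subspace of $X$ and in every block subspace of $X'$. If $X$ and $X'$ are not totally incomparable, then there exists $C>0$ such that for all $\ell\in\mathbb{N}$, $$\frac1C\le\frac{\lambda_\ell}{\lambda'_\ell}\le C,$$ where $\lambda_\ell=\big\|\sum_{i=1}^{\ell}e_i\big\|_X$ and $\lambda'_\ell=\big\|\sum_{i=1}^{\ell}e_i\big\|_{X'}$.
   Context: $\mathbb{N}=\{1,2,\dots\}$; $c_{00}$ is the space of eventually zero real sequences with unit vector basis $(e_i)$. For $E\subset\mathbb{N}$ and $x=\sum a_ie_i\in c_{00}$, $Ex=\sum_{i\in E}a_ie_i$. For finite $E,F\subset\mathbb{N}$, $E<F$ means $\max E<\min F$. $\mathcal{A}_k$ is the family of subsets of $\mathbb{N}$ with at most $k$ elements. Finite sets $E_1,\dots,E_n\subset\mathbb{N}$ are $\mathcal{A}_k$-admissible if there is $\{m_1,\dots,m_n\}\in\mathcal{A}_k$ with $m_1\le E_1<m_2\le E_2<\dots<m_n\le E_n$ (i.e. $n\le k$ and $E_1<\dots<E_n$). $T[(\mathcal{A}_k,\theta_k)_{k=1}^\infty]$ is the completion of $c_{00}$ under the norm $\|x\|=\sup_{s\ge0}|x|_s$, where $|x|_0=\|x\|_\infty$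 and $|x|_{s+1}=\max\{|x|_s,\ \sup_{k}\theta_k\sup\{\sum_{i=1}^n|E_ix|_s: n\in\mathbb{N},\ (E_i)_{i=1}^n\ \mathcal{A}_k\text{-admissible}\}\}$; this norm satisfies $\|x\|=\max\{\|x\|_\infty,\ \sup_{k}\theta_k\sup\{\sum_{i=1}^n\|E_ix\|: (E_i)_{i=1}^n\ \mathcal{A}_k\text{-admissible}\}\}$. A block sequence is a (finite or infinite) sequence of nonzero vectors of $c_{00}$ with successive supports; a block subspace is the closed linear span of an infinite block sequence $(u_i)_{i=1}^\infty$. $\ell_1$ is finitely block represented in that block subspace if for all $n\in\mathbb{N}$ and $\varepsilon>0$ there is a normalized block sequence $y_1,\dots,y_n$ of $(u_i)$ (finite linear combinations of the $u_i$, successively supported) which is $(1+\varepsilon)$-equivalent to the unit vector basis of $\ell_1^n$. ''Subspace'' means closed infinite-dimensional subspace. Two Banach spaces are totally incomparable if no subspace of one is isomorphic to any subspace of the other. *)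

(* Defs.v *)
(* World: MathComp + MathComp-Analysis; scalars are an arbitrary R : realType. *)
From HB Require Import structures.
From mathcomp Require Import all_boot all_order all_algebra finmap.
From mathcomp Require Import all_classical all_reals all_analysis.

Set Implicit Arguments.
Unset Strict Implicit.
Unset Printing Implicit Defensive.

Import Order.TTheory GRing.Theory Num.Theory.
Import numFieldNormedType.Exports.

Local Open Scope classical_set_scope.
Local Open Scope ring_scope.

(* Eventually zero real sequences are represented by polynomials: p`_i is the
   i-th coordinate and 'X^i the i-th unit vector.  Coordinates are numbered from
   0, so 'X^i stands for e_(i+1); this relabelling of positions does not affect
   the notions below, which depend on positions only through their order. *)
Notation c00 R := {poly R}.
Notation unit_vec i := ('X^i).

Section C00.
Variable R : realType.
Implicit Types (x : c00 R) (E : {fset nat}) (theta : nat -> R).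

Definition restr E x : c00 R := \sum_(i <- E) x`_i *: unit_vec i.

Definition supp x : {fset nat} := [fset i in iota 0 (size x) | x`_i != 0]%fset.

(* max E < min F for nonempty E, F (the only case in which it is used). *)
Definition fset_before (E F : {fset nat}) : Prop :=
  forall i j, i \in E -> j \in F -> (i < j)%N.

(* Finite (I = 'I_n) and infinite (I = nat) block sequences. *)
Definition block_seq d (I : porderType d) (u : I -> c00 R) : Prop :=
  (forall i, u i != 0) /\
  (forall i j : I, (i < j)%O -> fset_before (supp (u i)) (supp (u j))).

(* The family A_k; its members are all finite. *)
Definition A_ (k : nat) : set {fset nat} := [set E | (#|` E| <= k)%N].

(* {m_1, ..., m_n} in M with m_1 <= E_1 < m_2 <= E_2 < ... < m_n <= E_n. *)
Definition admissible (M : set {fset nat}) n (E : 'I_n -> {fset nat}) : Prop :=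
  (forall i, E i != fset0) /\
  exists m : 'I_n -> nat,
    [/\ M [fset m i | i in 'I_n]%fset,
        forall i p, p \in E i -> (m i <= p)%N
      & forall i j : 'I_n, j = i.+1 :> nat ->
          forall p, p \in E i -> (p < m j)%N].

Definition supnorm x : R := sup (range (fun i => `|x`_i|)).

(* |x|_s.  All the suprema are over nonempty sets bounded above by
   \sum_i `|x`_i|, as soon as theta k lies in [0, 1] for k >= 1; the value
   theta 0 is not used. *)
Fixpoint tnorm_level theta (s : nat) x : R :=
  if s is s'.+1 then
    Num.max (tnorm_level theta s' x)
      (sup [set theta k *
              sup [set r | exists n (E : 'I_n -> {fset nat}),
                     [/\ (0 < n)%N, admissible (A_ k) E
                       & r = \sum_(i < n) tnorm_level theta s' (restr (E i) x)]]
           | k in [set k | (0 < k)%N]])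
  else supnorm x.

Definition tnorm theta x : R := sup (range (fun s => tnorm_level theta s x)).

End C00.

Section Spaces.
Variable R : realType.

(* The Banach space X, with the linear map iota : c00 -> X, is a completion of
   c00 under the norm N; this determines X up to isometric isomorphism. *)
Definition is_completion (N : c00 R -> R) (X : completeNormedModType R)
    (iota : {linear c00 R -> X}) : Prop :=
  (forall x, `|iota x| = N x) /\ dense (range iota).

(* X = T[(A_k, theta_k)_k] *)
Definition is_T_A_space (theta : nat -> R) (X : completeNormedModType R)
    (iota : {linear c00 R -> X}) : Prop :=
  is_completion (tnorm theta) iota.

(* D-equivalence of y_1, ..., y_n to the unit vector basis of l_1^n. *)
Definition l1_equivalent (X : normedModType R) (D : R) n (y : 'I_n -> X) :
    Prop :=
  exists A B : R, [/\ 0 < A, 0 < B, A * B <= D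
    & forall a : 'I_n -> R,
        A^-1 * (\sum_(i < n) `|a i|) <= `|\sum_(i < n) a i *: y i|
          <= B * (\sum_(i < n) `|a i|)].

Definition l1_finitely_block_represented (X : normedModType R)
    (iota : {linear c00 R -> X}) (u : nat -> c00 R) : Prop :=
  forall (n : nat) (eps : R), (0 < n)%N -> 0 < eps ->
  exists y : 'I_n -> c00 R,
    [/\ block_seq y,
        forall j, exists m (c : 'I_m -> R), y j = \sum_(i < m) c i *: u i,
        forall j, `|iota (y j)| = 1
      & l1_equivalent (1 + eps) (fun j => iota (y j))].

(* A block subspace is given by the block sequence that spans it. *)
Definition l1_fbr_in_every_block_subspace (X : normedModType R)
    (iota : {linear c00 R -> X}) : Prop :=
  forall u : nat -> c00 R, block_seq u -> l1_finitely_block_represented iota u.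

Definition finite_dimensional (X : normedModType R) (Y : set X) : Prop :=
  exists n (v : 'I_n -> X), forall x, Y x ->
    exists a : 'I_n -> R, x = \sum_(i < n) a i *: v i.

Definition subspace_of (X : normedModType R) (Y : set X) : Prop :=
  [/\ submod_closed [in Y], closed Y & ~ finite_dimensional Y].

Definition linear_on (X X' : normedModType R) (Y : set X) (f : X -> X') : Prop :=
  forall (a : R) x y, Y x -> Y y -> f (a *: x + y) = a *: f x + f y.

(* Mutually inverse continuous linear maps between Y and Y'; the values of f
   outside Y and of g outside Y' are irrelevant. *)
Definition isomorphic (X X' : normedModType R) (Y : set X) (Y' : set X') : Prop :=
  exists (f : X -> X') (g : X' -> X),
    [/\ linear_on Y f, linear_on Y' g,
        {within Y, continuous f}, {within Y', continuous g}
      & [/\ forall x, Y x -> Y' (f x), forall x', Y' x' -> Y (g x'),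
            forall x, Y x -> g (f x) = x & forall x', Y' x' -> f (g x') = x']].

Definition totally_incomparable (X X' : completeNormedModType R) : Prop :=
  forall (Y : set X) (Y' : set X'),
    subspace_of Y -> subspace_of Y' -> ~ isomorphic Y Y'.

(* lambda_l = || e_1 + ... + e_l || *)
Definition lambda_ (X : normedModType R) (iota : {linear c00 R -> X}) (l : nat) :
    R :=
  `|iota (\sum_(i < l) unit_vec i)|.

(* Only the indices k >= 1 are constrained. *)
Definition admissible_weights (theta : nat -> R) : Prop :=
  [/\ forall k, (0 < k)%N -> 0 < theta k < 1,
      forall j k, (0 < j)%N -> (j <= k)%N -> theta k <= theta j
    & theta @ \oo --> (0 : R)].

End Spaces.

(* Main.v *)
(* If X and X' are not totally incomparable, a gliding hump in both spaces at
   once gives block sequences u of X and u' of X' that are equivalent.  For each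
   l, choose blocks x_0, ..., x_(l-1) of u that are averages of block sequences
   almost isometric to the bases of l_1^n, for rapidly increasing n.  Their sum
   has norm at most 3 lambda_l in X, while the corresponding blocks of u' have
   norms bounded below, so that their sum dominates a multiple of lambda'_l.
   Hence lambda' <= C lambda, and the situation is symmetric.

   For the upper estimate, cut the support of the sum into successive intervals.
   Up to small errors, the norm of a piece of a single x_i is its share of the
   mass of the average.  A fractional number of unit vectors is replaced by an
   integer one with an offset over which one averages: for each offset, the
   defining inequality of the norm applies to blocks of whole unit vectors, so
   no constant is lost when it is iterated. *)
Require Import Defs.
From HB Require Import structures.
From mathcomp Require Import all_boot all_order all_algebra finmap.
From mathcomp Require Import all_classical all_reals all_analysis.
From mathcomp Require Import zify ring lra.
Import Order.TTheory GRing.Theory Num.Theory.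
Import numFieldNormedType.Exports.
Local Open Scope classical_set_scope.
Local Open Scope ring_scope.

Set Implicit Arguments.
Unset Strict Implicit.
Unset Printing Implicit Defensive.

Section Cut.
Variable R : realType.
Implicit Types (x y : c00 R) (a b i : nat).

Definition cut a b x : c00 R := \sum_(a <= i < b) x`_i *: 'X^i.

Lemma coef_restr (E : {fset nat}) x i :
  (restr E x)`_i = if i \in E then x`_i else 0.
Proof.
rewrite /restr coef_sum; case: ifPn => iE.
  rewrite (bigD1_seq i) ?fset_uniq//= coefZ coefXn eqxx mulr1 big1 ?addr0// => j ji.
  by rewrite coefZ coefXn eq_sym (negPf ji) mulr0.
rewrite big_seq big1// => j jE; rewrite coefZ coefXn.
by case: eqP => [ij|_]; rewrite ?mulr0//; rewrite ij jE in iE.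
Qed.

Lemma coef_cut a b x i : (cut a b x)`_i = if (a <= i < b)%N then x`_i else 0.
Proof.
rewrite /cut coef_sum; case: ifPn => iE.
  rewrite (bigD1_seq i) ?mem_index_iota ?iota_uniq//=.
  rewrite coefZ coefXn eqxx mulr1 big1 ?addr0// => j ji.
  by rewrite coefZ coefXn eq_sym (negPf ji) mulr0.
rewrite big_seq big1// => j; rewrite mem_index_iota => jE; rewrite coefZ coefXn.
by case: eqP => [ij|_]; rewrite ?mulr0//; rewrite ij jE in iE.
Qed.

Lemma cut_linear a b : linear (cut a b).
Proof.
move=> c x y; apply/polyP => i; rewrite coefD coefZ !coef_cut.
by case: ifP => _; rewrite ?coefD ?coefZ// mulr0 addr0.
Qed.

HB.instance Definition _ a b :=
  GRing.isLinear.Build R (c00 R) (c00 R) *:%R (cut a b) (@cut_linear a b).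

Lemma cut_restr a b x :
  cut a b x = restr [fset i in index_iota a b]%fset x.
Proof.
by apply/polyP => i; rewrite coef_cut coef_restr !inE/= mem_index_iota.
Qed.

Lemma cut_full a b x :
  (forall i, x`_i != 0 -> (a <= i < b)%N) -> cut a b x = x.
Proof.
move=> h; apply/polyP => i; rewrite coef_cut; case: ifPn => // /negP ni.
by apply/eqP; rewrite eq_sym; apply/contraT => /h.
Qed.

Lemma cut_eq0 a b x :
  (forall i, (a <= i < b)%N -> x`_i = 0) -> cut a b x = 0.
Proof.
by move=> h; apply/polyP => i; rewrite coef_cut coef0; case: ifP => // /h.
Qed.

Lemma cut_cut a b c d x :
  (a <= c)%N -> (d <= b)%N -> cut c d (cut a b x) = cut c d x.
Proof.
move=> ac db; apply/polyP => i; rewrite !coef_cut; case: ifP => // cd.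
by rewrite ifT//; lia.
Qed.

End Cut.

Section Tnorm.
Variables (R : realType) (theta : nat -> R).
Implicit Types (x y : c00 R) (a b i : nat) (P : nat -> nat -> R).

Hypothesis theta01 : forall k, (0 < k)%N -> 0 < theta k < 1.

Lemma theta_ge0 k : (0 < k)%N -> 0 <= theta k.
Proof. by move=> /theta01/andP[/ltW]. Qed.

Lemma theta_le1 k : (0 < k)%N -> theta k <= 1.
Proof. by move=> /theta01/andP[_ /ltW]. Qed.

Definition level_sums s k x : set R := [set r | exists n (E : 'I_n -> {fset nat}),
  [/\ (0 < n)%N, admissible (A_ k) E
    & r = \sum_(i < n) tnorm_level theta s (restr (E i) x)]].

Lemma level_sums_neq0 s k x : (0 < k)%N -> level_sums s k x !=set0.
Proof.
move=> k0; exists (\sum_(i < 1) tnorm_level theta s (restr [fset 0%N]%fset x)).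
exists 1%N, (fun=> [fset 0%N]%fset); split => //; split.
  by move=> _; apply/fset0Pn; exists 0%N; rewrite inE.
exists (fun=> 0%N); split.
- rewrite /A_ /=; apply: leq_trans k0.
  apply: (@leq_trans #|` [fset 0%N]%fset|); last by rewrite cardfs1.
  by apply/fsubset_leq_card/fsubsetP => ? /imfsetP[? _ ->]; rewrite inE.
- by move=> ? p.
- by move=> i j; rewrite !ord1.
Qed.

(* The intervals [m i, m i.+1) may be empty; cut at them, an admissible family
   becomes a partition of [a, b), which is all that the estimates use. *)
Lemma admissible_breakpoints k n (E : 'I_n -> {fset nat}) a b :
  (0 < n)%N -> admissible (A_ k) E ->
  (a <= b)%N ->
  exists m : nat -> nat, [/\ (n <= k)%N, {homo m : i j / (i <= j)%N}, m 0%N = a, m n = b &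
    forall (i : 'I_n) p, p \in E i -> (a <= p < b)%N -> (m i <= p < m i.+1)%N].
Proof.
move=> n0 [E0 [m [mk mE Em]]] ab.
have mlt (i j : 'I_n) : j = i.+1 :> nat -> (m i < m j)%N.
  move=> ji; have /fset0Pn[p pE] := E0 i.
  exact: leq_ltn_trans (mE _ _ pE) (Em _ _ ji _ pE).
have mle (i j : 'I_n) : (i <= j)%N -> (m i + (j - i) <= m j)%N.
  case: j => j jn /= ij; elim: j jn ij => [|j IH] jn ij.
    have -> : i = Ordinal jn by apply/val_inj => /=; lia.
    by rewrite subnn addn0.
  move: ij; rewrite leq_eqVlt => /orP[/eqP ij|ij].
    have -> : i = Ordinal jn by apply/val_inj => /=; lia.
    by rewrite subnn addn0.
  have jn' : (j < n)%N by lia.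
  have := IH jn' ij; have := mlt (Ordinal jn') (Ordinal jn) erefl; lia.
have minj : injective m.
  by move=> i j mij; apply/val_inj => /=; have := mle i j; have := mle j i; lia.
pose m' i := if i is 0 then a else
  if insub i is Some j then maxn a (minn b (m j)) else b.
have m'E (i : 'I_n) : (0 < i)%N -> m' i = maxn a (minn b (m i)).
  case: i => -[|i] ni // _; rewrite /m' /=; case: insubP => /=; last by rewrite ni.
  by move=> j _ ji; congr (maxn _ (minn _ (m _))); apply/val_inj.
have m'n i : (n <= i)%N -> m' i = b.
  move=> ni; rewrite /m'; case: i ni => [|i] ni; first by lia.
  by case: insubP => //= j ij; lia.
have m'ab i : (a <= m' i <= b)%N.
  have [ni|ni] := leqP n i; first by rewrite m'n//; lia.
  case: i ni => [|i] ni; first by rewrite /=; lia.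
  by rewrite (m'E (Ordinal ni))//; lia.
exists m'; split => //.
- by move: mk; rewrite /A_/= card_imfset//= size_enum_ord.
- move=> i j ij; have [nj|nj] := leqP n j.
    by rewrite (m'n j)//; have := m'ab i; lia.
  case: i ij => [|i] ij; first by case/andP: (m'ab j).
  have ni : (i.+1 < n)%N by lia.
  rewrite (m'E (Ordinal ni))// (m'E (Ordinal nj))//=; last by lia.
  by have := mle (Ordinal ni) (Ordinal nj) ij; lia.
- exact: m'n.
- move=> i p pE pab; apply/andP; split.
    case: (posnP i) => [->|i0]; first by rewrite /=; lia.
    by rewrite (m'E i)//; have := mE _ _ pE; lia.
  have [ni|ni] := leqP n i.+1; first by rewrite m'n//; lia.
  rewrite (m'E (Ordinal ni))//=.
  by have := Em i (Ordinal ni) erefl _ pE; lia.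
Qed.

Lemma breakpoints_admissible k n (m : nat -> nat) :
  (n <= k)%N -> {homo m : i j / (i <= j)%N} -> (m 0%N < m n)%N ->
  exists n' (E : 'I_n' -> {fset nat}), [/\ (0 < n')%N, admissible (A_ k) E &
    forall (F : c00 R -> R) x, F 0 = 0 ->
    \sum_(0 <= j < n) F (cut (m j) (m j.+1) x) = \sum_(i < n') F (restr (E i) x)].
Proof.
move=> nk mm m0n; pose S := [seq j <- index_iota 0 n | (m j < m j.+1)%N].
pose E (i : 'I_(size S)) := [fset p in index_iota (m (nth 0%N S i)) (m (nth 0%N S i).+1)]%fset.
have sS : (size S <= n)%N.
  by apply: leq_trans (size_subseq (filter_subseq _ _)) _; rewrite size_iota subn0.
have mS (i : 'I_(size S)) : (m (nth 0%N S i) < m (nth 0%N S i).+1)%N.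
  by have := mem_nth 0%N (ltn_ord i); rewrite mem_filter => /andP[].
exists (size S), E; split.
- rewrite lt0n; apply/negP => /eqP/size0nil S0.
  suff : forall i, (i <= n)%N -> m i = m 0%N by move=> /(_ n (leqnn _)); lia.
  elim=> // i IH lin; have := IH (ltnW lin).
  have : i \notin S by rewrite S0.
  rewrite mem_filter mem_index_iota lin /= andbT -leqNgt => h1 h2.
  by have := mm i i.+1 (leqnSn _); lia.
- split.
    move=> i; apply/fset0Pn; exists (m (nth 0%N S i)); rewrite !inE/= mem_index_iota.
    by rewrite leqnn mS.
  exists (fun i => m (nth 0%N S i)); split.
  + rewrite /A_ /=; apply: leq_trans nk; apply: leq_trans sS.
    by apply: leq_trans (leq_imfset_card _ _ _) _; rewrite /= size_enum_ord.
  + by move=> i p; rewrite !inE/= mem_index_iota => /andP[].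
  + move=> i j ji p; rewrite !inE/= mem_index_iota => /andP[_ pm].
    apply: leq_trans pm _; apply: mm.
    have sorS : sorted ltn S by apply: (sorted_filter ltn_trans); exact: iota_ltn_sorted.
    by apply: (sorted_ltn_nth ltn_trans); rewrite // ?inE ?ltn_ord// ji.
- move=> F x F0; transitivity (\sum_(j <- S) F (cut (m j) (m j.+1) x)).
    rewrite [RHS]big_filter [RHS]big_mkcond; apply: eq_bigr => j _.
    case: ifPn => //; rewrite -leqNgt => h.
    by rewrite cut_eq0// => i; lia.
  rewrite (big_nth 0%N) big_mkord; apply: eq_bigr => i _.
  by rewrite cut_restr.
Qed.
End Tnorm.

Section TnormBounds.
Variables (R : realType) (theta : nat -> R).
Implicit Types (x y : c00 R) (a b i : nat) (P : nat -> nat -> R).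

Hypothesis theta01 : forall k, (0 < k)%N -> 0 < theta k < 1.

Lemma restr_restr (E F : {fset nat}) x :
  restr E (restr F x) = restr (E `&` F)%fset x.
Proof.
apply/polyP => i; rewrite !coef_restr inE.
by case: (i \in E).
Qed.

Lemma tnorm_level_le x P :
  (forall a b, (a <= b)%N -> 0 <= P a b) ->
  (forall a b i, (a <= i < b)%N -> `|x`_i| <= P a b) ->
  (forall k n (m : nat -> nat), (0 < k)%N -> (n <= k)%N ->
    {homo m : i j / (i <= j)%N} ->
    theta k * (\sum_(0 <= j < n) P (m j) (m j.+1)) <= P (m 0%N) (m n)) ->
  forall s a b (F : {fset nat}), (a <= b)%N ->
    (forall p, p \in F -> (a <= p < b)%N) ->
    tnorm_level theta s (restr F x) <= P a b.
Proof.
move=> Pge0 Psup PS; elim=> [|s IH] a b F ab Fab /=.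
  apply: ge_sup; first by exists `|(restr F x)`_0|, 0%N.
  move=> _ [i _ <-]; rewrite coef_restr; case: ifPn => [iF|_].
    by apply: Psup; exact: Fab.
  by rewrite normr0 Pge0.
rewrite ge_max IH//=; apply: ge_sup.
  by exists (theta 1 * sup (level_sums theta s 1 (restr F x))), 1%N.
move=> _ [k /= k0 <-].
rewrite -ler_pdivlMl; last by case/andP: (theta01 k0).
apply: ge_sup; first exact: level_sums_neq0.
move=> _ [n [E [n0 Eadm ->]]].
have [m [nk mm m0 mn mE]] := admissible_breakpoints n0 Eadm ab.
rewrite ler_pdivlMl; last by case/andP: (theta01 k0).
rewrite -m0 -mn; apply: le_trans (PS k n m k0 nk mm).
apply: ler_wpM2l; first exact: theta_ge0.
rewrite big_mkord; apply: ler_sum => i _; rewrite restr_restr.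
apply: IH; first exact: mm.
by move=> p; rewrite inE => /andP[pE /Fab]; exact: mE.
Qed.

Lemma tnorm_cut_le x P :
  (forall a b, (a <= b)%N -> 0 <= P a b) ->
  (forall a b i, (a <= i < b)%N -> `|x`_i| <= P a b) ->
  (forall k n (m : nat -> nat), (0 < k)%N -> (n <= k)%N ->
    {homo m : i j / (i <= j)%N} ->
    theta k * (\sum_(0 <= j < n) P (m j) (m j.+1)) <= P (m 0%N) (m n)) ->
  forall a b, (a <= b)%N -> tnorm theta (cut a b x) <= P a b.
Proof.
move=> Pge0 Psup PS a b ab; apply: ge_sup.
  by exists (tnorm_level theta 0 (cut a b x)), 0%N.
move=> _ [s _ <-]; rewrite cut_restr; apply: tnorm_level_le => // p.
by rewrite !inE /= mem_index_iota.
Qed.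

Definition l1norm a b x := \sum_(a <= i < b) `|x`_i|.

Lemma l1norm_ge0 a b x : 0 <= l1norm a b x.
Proof. by apply: sumr_ge0 => i _. Qed.

Lemma coef_l1norm a b x i : (a <= i < b)%N -> `|x`_i| <= l1norm a b x.
Proof.
move=> iab; rewrite /l1norm (bigD1_seq i) ?mem_index_iota ?iota_uniq//=.
by rewrite lerDl sumr_ge0.
Qed.

Lemma l1norm_breakpoints x n (m : nat -> nat) : {homo m : i j / (i <= j)%N} ->
  \sum_(0 <= j < n) l1norm (m j) (m j.+1) x = l1norm (m 0%N) (m n) x.
Proof.
move=> mm; elim: n => [|n IH]; first by rewrite big_geq// /l1norm big_geq.
by rewrite big_nat_recr//= IH /l1norm -big_cat_nat//; apply: mm.
Qed.

Lemma tnorm_level_l1norm s a b (F : {fset nat}) x : (a <= b)%N ->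
  (forall p, p \in F -> (a <= p < b)%N) ->
  tnorm_level theta s (restr F x) <= l1norm a b x.
Proof.
apply: (tnorm_level_le (P := fun a b => l1norm a b x)).
- by move=> *; exact: l1norm_ge0.
- by move=> *; exact: coef_l1norm.
- move=> k n m k0 nk mm; rewrite l1norm_breakpoints//.
  by rewrite ler_piMl// ?l1norm_ge0// theta_le1.
Qed.

Lemma cut_size x : cut 0 (size x) x = x.
Proof.
by apply: cut_full => i; apply: contra_neqT; rewrite -leqNgt; exact: nth_default.
Qed.

Lemma tnorm_level_ub s x : tnorm_level theta s x <= l1norm 0 (size x) x.
Proof.
rewrite -{1}(cut_size x) cut_restr; apply: tnorm_level_l1norm => // p.
by rewrite !inE/= mem_index_iota.
Qed.

Lemma level_sums_ub s k x : ubound (level_sums theta s k x) (l1norm 0 (size x) x).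
Proof.
move=> _ [n [E [n0 Eadm ->]]].
have [m [nk mm m0 mn mE]] := admissible_breakpoints n0 Eadm (leq0n (size x)).
rewrite -[X in l1norm X]m0 -mn -l1norm_breakpoints// big_mkord.
apply: ler_sum => i _; rewrite -{1}(cut_size x) cut_restr restr_restr.
apply: tnorm_level_l1norm; first exact: mm.
by move=> p; rewrite !inE /= mem_index_iota => /andP[pE]; exact: mE.
Qed.

Lemma supnorm_ub x : has_ubound (range (fun i => `|x`_i|)).
Proof.
exists (l1norm 0 (size x) x) => _ [i _ <-].
have [si|si] := leqP (size x) i; first by rewrite nth_default// normr0 l1norm_ge0.
exact: coef_l1norm.
Qed.

Lemma tnorm_has_ub x : has_ubound (range (fun s => tnorm_level theta s x)).
Proof. by exists (l1norm 0 (size x) x) => _ [s _ <-]; exact: tnorm_level_ub. Qed.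

Lemma tnorm_level_le_tnorm s x : tnorm_level theta s x <= tnorm theta x.
Proof. by apply: ub_le_sup; [exact: tnorm_has_ub|exists s]. Qed.

Lemma coef_le_tnorm x i : `|x`_i| <= tnorm theta x.
Proof.
apply: le_trans (tnorm_level_le_tnorm 0 x).
by apply: ub_le_sup; [exact: supnorm_ub|exists i].
Qed.

Lemma tnorm_ge0 x : 0 <= tnorm theta x.
Proof. exact: le_trans (coef_le_tnorm x 0). Qed.

Lemma tnorm_level_nondecreasing x :
  nondecreasing_seq (fun s => tnorm_level theta s x).
Proof.
by apply/nondecreasing_seqP => s /=; rewrite le_max lexx.
Qed.

Lemma tnorm_level_cvg x : tnorm_level theta ^~ x @ \oo --> tnorm theta x.
Proof.
by apply: nondecreasing_cvgn; [exact: tnorm_level_nondecreasing|exact: tnorm_has_ub].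
Qed.

Lemma tnorm_level_step s k n (E : 'I_n -> {fset nat}) x :
  (0 < k)%N -> (0 < n)%N -> admissible (A_ k) E ->
  theta k * \sum_(i < n) tnorm_level theta s (restr (E i) x)
    <= tnorm_level theta s.+1 x.
Proof.
move=> k0 n0 Eadm; rewrite /= le_max; apply/orP; right.
apply: (@le_trans _ _ (theta k * sup (level_sums theta s k x))).
  apply: ler_wpM2l; first exact: theta_ge0.
  apply: ub_le_sup; last by exists n, E.
  by exists (l1norm 0 (size x) x); exact: level_sums_ub.
apply: ub_le_sup; last by exists k.
exists (l1norm 0 (size x) x) => _ [j /= j0 <-].
apply: (@le_trans _ _ (sup (level_sums theta s j x))).
  rewrite ler_piMl// ?theta_le1//.
  have [r rS] := level_sums_neq0 theta s x j0.
  have r0 : 0 <= r.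
    case: rS => n' [E' [n'0 _ ->]]; apply: sumr_ge0 => i _.
    apply: le_trans (tnorm_level_nondecreasing _ (leq0n s)).
    apply: le_trans (_ : `|(restr (E' i) x)`_0| <= _) => //.
    by apply: ub_le_sup; [exact: supnorm_ub|exists 0%N].
  apply: le_trans r0 _; apply: ub_le_sup => //.
  by exists (l1norm 0 (size x) x); exact: level_sums_ub.
by apply: ge_sup; [exact: level_sums_neq0|exact: level_sums_ub].
Qed.

Lemma tnorm_admissible k n (E : 'I_n -> {fset nat}) x :
  (0 < k)%N -> (0 < n)%N -> admissible (A_ k) E ->
  theta k * \sum_(i < n) tnorm theta (restr (E i) x) <= tnorm theta x.
Proof.
move=> k0 n0 Eadm.
have cv : (fun s => theta k * \sum_(i < n) tnorm_level theta s (restr (E i) x))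
   @ \oo --> theta k * \sum_(i < n) tnorm theta (restr (E i) x).
  apply: cvgMl_tmp; apply: cvg_big => [|i _]; first exact: add_continuous.
  exact: tnorm_level_cvg.
apply: (cvgr_to_le cv); near=> s; apply: le_trans (tnorm_level_le_tnorm s.+1 x).
exact: tnorm_level_step.
Unshelve. all: by end_near.
Qed.

Lemma tnorm0 : tnorm theta 0 = 0.
Proof.
apply/eqP; rewrite eq_le tnorm_ge0 andbT.
rewrite -(@cut_eq0 R 0 0 0); last by move=> i; rewrite coef0.
apply: (tnorm_cut_le (P := fun _ _ => 0)) => //.
- by move=> *; rewrite coef0 normr0.
- by move=> *; rewrite big1 ?mulr0.
Qed.

Lemma tnorm_breakpoints k n (m : nat -> nat) x :
  (0 < k)%N -> (n <= k)%N -> {homo m : i j / (i <= j)%N} ->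
  theta k * \sum_(0 <= j < n) tnorm theta (cut (m j) (m j.+1) x)
    <= tnorm theta (cut (m 0%N) (m n) x).
Proof.
move=> k0 nk mm; have [m0n|] := ltnP (m 0%N) (m n).
  have [n' [E [n'0 Eadm EF]]] := breakpoints_admissible R nk mm m0n.
  rewrite [X in _ * X <= _](_ : _ = \sum_(0 <= j < n)
      tnorm theta (cut (m j) (m j.+1) (cut (m 0%N) (m n) x))); last first.
    rewrite big_nat [RHS]big_nat; apply: eq_bigr => j /andP[_ jn].
    by rewrite cut_cut//; apply: mm.
  by rewrite EF ?tnorm0//; apply: tnorm_admissible.
move=> mn; rewrite big_nat big1 ?mulr0 ?tnorm_ge0// => j /andP[_ jn].
rewrite cut_eq0 ?tnorm0// => i.
by have := mm 0%N j (leq0n j); have := mm j.+1 n jn; lia.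
Qed.

Lemma tnorm_cut_le_l1norm a b x : (a <= b)%N -> tnorm theta (cut a b x) <= l1norm a b x.
Proof.
apply: (tnorm_cut_le (P := fun a b => l1norm a b x)).
- by move=> *; exact: l1norm_ge0.
- by move=> *; exact: coef_l1norm.
- move=> k n m k0 nk mm; rewrite l1norm_breakpoints//.
  by rewrite ler_piMl// ?l1norm_ge0// theta_le1.
Qed.

Lemma tnorm_mono x y : (forall i, `|x`_i| <= `|y`_i|) ->
  tnorm theta x <= tnorm theta y.
Proof.
move=> xy; pose b := maxn (size x) (size y).
have cutE (z : c00 R) : (size z <= b)%N -> cut 0 b z = z.
  move=> zb; apply: cut_full => i; apply: contra_neqT; rewrite -leqNgt => bi.
  by rewrite nth_default// (leq_trans zb).
rewrite -(cutE x) ?leq_maxl// -(cutE y) ?leq_maxr//.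
apply: (tnorm_cut_le (P := fun a b => tnorm theta (cut a b y))) => //.
- by move=> *; exact: tnorm_ge0.
- move=> a c i aic; apply: le_trans (xy i) _.
  by apply: le_trans (coef_le_tnorm _ i); rewrite coef_cut aic.
- by move=> k n m k0 nk mm; exact: tnorm_breakpoints.
Qed.

Lemma tnorm_cut_mono a b c d x : (a <= c)%N -> (d <= b)%N ->
  tnorm theta (cut c d x) <= tnorm theta (cut a b x).
Proof.
move=> ac db; apply: tnorm_mono => i; rewrite !coef_cut.
case: ifP => cid; last by rewrite normr0.
by rewrite ifT//; lia.
Qed.

Lemma tnorm_cut x a b : tnorm theta (cut a b x) <= tnorm theta x.
Proof.
by apply: tnorm_mono => i; rewrite coef_cut; case: ifP; rewrite ?normr0.
Qed.

End TnormBounds.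

Section TnormSeminorm.
Variables (R : realType) (theta : nat -> R).
Implicit Types (x y : c00 R).
Hypothesis theta01 : forall k, (0 < k)%N -> 0 < theta k < 1.
Local Notation N := (tnorm theta).

Lemma coef_le_tnorm_cut a b x i : (a <= i < b)%N -> `|x`_i| <= N (cut a b x).
Proof.
by move=> iab; apply: le_trans (coef_le_tnorm theta01 _ i); rewrite coef_cut iab.
Qed.

Lemma tnormD x y : N (x + y) <= N x + N y.
Proof.
pose s := maxn (size x) (size y).
have cutE (z : c00 R) : (size z <= s)%N -> cut 0 s z = z.
  move=> zs; apply: cut_full => i; apply: contra_neqT; rewrite -leqNgt => si.
  by rewrite nth_default// (leq_trans zs).
suff : N (cut 0 s (x + y)) <= N (cut 0 s x) + N (cut 0 s y).
  by rewrite !cutE ?size_polyD ?leq_maxl ?leq_maxr.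
apply: (tnorm_cut_le theta01 (P := fun a b => N (cut a b x) + N (cut a b y))) => //.
- by move=> *; rewrite addr_ge0 ?tnorm_ge0.
- move=> a b i iab; rewrite coefD; apply: le_trans (ler_normD _ _) _.
  by apply: lerD; exact: coef_le_tnorm_cut.
- move=> k n m k0 nk mm; rewrite big_split/= mulrDr.
  by apply: lerD; apply: tnorm_breakpoints.
Qed.

Lemma tnorm_sum (I : Type) (r : seq I) (Q : pred I) (F : I -> c00 R) :
  N (\sum_(i <- r | Q i) F i) <= \sum_(i <- r | Q i) N (F i).
Proof.
elim/big_rec2: _ => [|i y x _ IH]; first by rewrite tnorm0.
by apply: le_trans (tnormD _ _) _; rewrite lerD2l.
Qed.

Lemma tnormZ_le (c : R) x : N (c *: x) <= `|c| * N x.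
Proof.
rewrite -{1}(cut_size x) -{1}linearZ -[in leRHS](cut_size x) /=.
apply: (tnorm_cut_le theta01 (P := fun a b => `|c| * N (cut a b x))) => //.
- by move=> *; rewrite mulr_ge0 ?tnorm_ge0.
- move=> a b i iab; rewrite coefZ normrM ler_wpM2l//.
  exact: coef_le_tnorm_cut.
- move=> k n m k0 nk mm; rewrite -mulr_sumr mulrCA ler_wpM2l//.
  exact: tnorm_breakpoints.
Qed.

End TnormSeminorm.

Section Blocks.
Variables (R : realType) (theta : nat -> R).
Implicit Types (x y z : nat -> c00 R).
Hypothesis theta01 : forall k, (0 < k)%N -> 0 < theta k < 1.
Local Notation N := (tnorm theta).

Definition supported (b : nat -> nat) (l : nat) z :=
  forall i p, (i < l)%N -> (z i)`_p != 0 -> (b i <= p < b i.+1)%N.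

Definition ones a b : c00 R := \sum_(a <= i < b) 'X^i.

Lemma coef_ones a b i : (ones a b)`_i = (a <= i < b)%:R.
Proof.
have -> : ones a b = cut a b (\poly_(i < b) 1).
  rewrite /ones /cut big_nat [RHS]big_nat; apply: eq_bigr => j /andP[_ jb].
  by rewrite coef_poly jb scale1r.
by rewrite coef_cut coef_poly; case: (leqP a i) => //=; case: (i < b)%N.
Qed.

Lemma cut_ones a b c d : (a <= c)%N -> (d <= b)%N -> cut c d (ones a b) = ones c d.
Proof.
move=> ac db; apply/polyP => i; rewrite coef_cut !coef_ones; case: ifP => // cd.
by congr (_%:R); apply/eqP; rewrite eqb1; lia.
Qed.

Lemma coef_sum_supported b l z i p : {homo b : i j / (i <= j)%N} ->
  supported b l z -> (i < l)%N -> (b i <= p < b i.+1)%N ->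
  (\sum_(0 <= j < l) z j)`_p = (z i)`_p.
Proof.
move=> mb sz il pi; rewrite coef_sum (bigD1_seq i) ?mem_index_iota ?iota_uniq//=.
rewrite big_seq_cond big1 ?addr0// => j /andP[]; rewrite mem_index_iota => /andP[_ jl] ji.
apply/eqP; apply: contraT => /(sz _ _ jl) pj.
have [ij|ij|ij] := ltngtP i j; last by rewrite ij eqxx in ji.
- by have := mb _ _ ij; lia.
- by have := mb _ _ ij; lia.
Qed.

Lemma cut_sum_supported b l z i : {homo b : i j / (i <= j)%N} ->
  supported b l z -> (i < l)%N ->
  cut (b i) (b i.+1) (\sum_(0 <= j < l) z j) = z i.
Proof.
move=> mb sz il; apply/polyP => p; rewrite coef_cut; case: ifP => pi.
  exact: coef_sum_supported pi.
apply/eqP; rewrite eq_sym; apply: contraT => /(sz _ _ il).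
by rewrite pi.
Qed.

Lemma tnorm_blocks_ge l z b (k : R) : {homo b : i j / (i <= j)%N} ->
  supported b l z -> 0 < k -> (forall i, (i < l)%N -> k <= N (z i)) ->
  k * N (ones 0 l) <= N (\sum_(0 <= i < l) z i).
Proof.
move=> mb sz k0 kz; rewrite -ler_pdivlMl//.
set Z := \sum_(0 <= i < l) z i.
apply: le_trans (_ : k^-1 * N (cut (b 0%N) (b l) Z) <= _); last first.
  by rewrite ler_wpM2l ?invr_ge0 ?(ltW k0)// tnorm_cut.
rewrite -(@cut_ones 0 l 0 l)//.
apply: (tnorm_cut_le theta01 (P := fun p q => k^-1 * N (cut (b p) (b q) Z))) => //.
- by move=> *; rewrite mulr_ge0 ?invr_ge0 ?(ltW k0)// tnorm_ge0.
- move=> p q i ipq; rewrite coef_ones /=.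
  have [il|il] := ltnP i l; last first.
    by rewrite normr0 mulr_ge0 ?invr_ge0 ?(ltW k0)// tnorm_ge0.
  rewrite normr1 ler_pdivlMl// mulr1; apply: le_trans (kz i il) _.
  rewrite -(cut_sum_supported mb sz il).
  by apply: tnorm_cut_mono => //; apply: mb; lia.
- move=> j n m j0 nj mm; rewrite -mulr_sumr mulrCA ler_wpM2l ?invr_ge0 ?(ltW k0)//.
  apply: (tnorm_breakpoints theta01 (m := b \o m)) => // p q pq /=.
  exact/mb/mm.
Qed.

Lemma in_supp (x : c00 R) i : (i \in supp x) = (x`_i != 0).
Proof.
rewrite /supp !inE/= mem_iota add0n /=; case: ltnP => //= xi.
by rewrite nth_default ?eqxx.
Qed.

Lemma tnorm_average n (y : 'I_n -> c00 R) : (0 < n)%N -> block_seq y ->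
  (forall j, N (y j) <= 1) ->
  exists g : nat -> nat, [/\ {homo g : i j / (i <= j)%N}, forall t, (g t <= n)%N
    & forall a b, (a <= b)%N ->
      N (cut a b (n%:R^-1 *: \sum_(j < n) y j)) * n%:R <= (g b - g a).+1%:R].
Proof.
move=> n0 [y0 yb] y1; exists (fun t => \sum_(j < n) (size (y j) <= t))%N; split.
- by move=> s t st; apply: leq_sum => j _; case: (leqP _ s) => // sj; rewrite (leq_trans sj st).
- move=> t; apply: (@leq_trans (\sum_(j < n) 1)%N).
    by apply: leq_sum => j _; case: (size (y j) <= t)%N.
  by rewrite sum1_card card_ord.
move=> a b ab.
pose late j := (b < size (y j))%N && (cut a b (y j) != 0).
have late_inj (i j : 'I_n) : (i < j)%N -> ~~ (late i && late j).
  move=> ij; apply/negP => /andP[/andP[bi _] /andP[_ jcut]].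
  have /existsNP[q] : ~ forall q, (a <= q < b)%N -> (y j)`_q = 0.
    by move=> /cut_eq0 j0; rewrite j0 eqxx in jcut.
  move=> /not_implyP[qab /eqP yjq].
  have ylast : (y i)`_(size (y i)).-1 != 0 by rewrite -lead_coefE lead_coef_eq0.
  by have := yb i j ij (size (y i)).-1 q; rewrite !in_supp => /(_ ylast yjq); lia.
have late1 : (\sum_(j < n) late j <= 1)%N.
  have [i li|nolate] := pickP late; last by rewrite big1// => j _; rewrite nolate.
  rewrite (bigD1 i)//= li big1// => j ji; apply/eqP; rewrite eqb0.
  apply/negP => lj; have [ij|ij|/val_inj ij] := ltngtP i j.
  - by have := late_inj _ _ ij; rewrite li lj.
  - by have := late_inj _ _ ij; rewrite li lj.
  - by rewrite ij eqxx in ji.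
rewrite linearZ linear_sum /=.
apply: le_trans (ler_wpM2r (ler0n _ _) (tnormZ_le theta01 _ _)) _.
rewrite ger0_norm ?invr_ge0// mulrAC mulVf ?mul1r ?pnatr_eq0 -?lt0n//.
apply: le_trans (tnorm_sum theta01 _ _ _) _.
apply: (@le_trans _ _ (\sum_(j < n) ((size (y j) <= b) - (size (y j) <= a) + late j)%N%:R)).
  apply: ler_sum => j _; have [->|cj] := eqVneq (cut a b (y j)) 0.
    by rewrite tnorm0.
  apply: (@le_trans _ _ 1); first by apply: le_trans (tnorm_cut _ _ _ _) (y1 j).
  rewrite ler1n /late cj andbT.
  have sa : (a < size (y j))%N.
    rewrite ltnNge; apply: contra cj => ya; apply/eqP/cut_eq0 => i /andP[ai _].
    by rewrite nth_default// (leq_trans ya).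
  by rewrite (leqNgt _ a) sa subn0; case: (ltnP b (size (y j))).
rewrite -natr_sum ler_nat big_split /= -addn1 leq_add//.
rewrite sumnB// => j _; case: (leqP (size (y j)) a) => // sa.
by rewrite (leq_trans sa ab).
Qed.

End Blocks.

Lemma sum_divn_shift (N T : nat) : (0 < N)%N ->
  (\sum_(0 <= u < N) (T + u) %/ N = T)%N.
Proof.
move=> N0; elim: T => [|T IH].
  by rewrite big_nat big1// => u /andP[_ uN]; rewrite add0n divn_small.
have : (\sum_(0 <= u < N.+1) (T + u) %/ N =
    \sum_(0 <= u < N) (T + u) %/ N + (T + N) %/ N)%N by rewrite big_nat_recr.
rewrite big_nat_recl//= IH addn0 divnDr ?dvdnn// divnn N0.
under eq_bigr do rewrite addnS -addSn.
lia.
Qed.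

Lemma last_index_le (b : nat -> nat) l s : (0 < l)%N ->
  {homo b : i j / (i <= j)%N} ->
  exists2 i0, (i0 < l)%N &
    (forall i, (i < i0)%N -> (b i.+1 <= s)%N) /\
    (forall i, (i0 < i < l)%N -> (s < b i)%N).
Proof.
move=> l0 mb; elim: l l0 => // -[|m] IH _.
  by exists 0%N => //; split => // i; rewrite ltnS; case: i.
have [bs|bs] := leqP (b m.+1) s.
  exists m.+1 => //; split; last by move=> i; lia.
  by move=> i im; apply: leq_trans bs; apply: mb; lia.
have [i0 i0m [lo hi]] := IH isT.
exists i0; first by lia.
split=> // i /andP[i0i]; rewrite ltnS leq_eqVlt => /orP[/eqP->//|im].
by apply: hi; rewrite i0i.
Qed.

Section RapidlyIncreasing.
Variables (R : realType) (theta : nat -> R).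
Hypothesis theta01 : forall k, (0 < k)%N -> 0 < theta k < 1.
Hypothesis theta_noninc : forall j k, (0 < j)%N -> (j <= k)%N -> theta k <= theta j.
Local Notation N := (tnorm theta).

Variables (l : nat) (x : nat -> c00 R) (b n : nat -> nat) (g : nat -> nat -> nat).
Variables (delta c eta : R) (M : nat).
Hypothesis l0 : (0 < l)%N.
Hypothesis mb : {homo b : i j / (i <= j)%N}.
Hypothesis sx : supported b l x.
Hypothesis n0 : forall i, (i < l)%N -> (0 < n i)%N.
Hypothesis mg : forall i, (i < l)%N -> {homo g i : s t / (s <= t)%N}.
Hypothesis gn : forall i t, (i < l)%N -> (g i t <= n i)%N.
Hypothesis xg : forall i s t, (i < l)%N -> (s <= t)%N ->
  N (cut s t (x i)) * (n i)%:R <= (g i t - g i s).+1%:R.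
Hypothesis delta_n : forall i, (i < l)%N -> 1 <= delta * (n i)%:R.
Hypothesis delta_M : M%:R * delta <= (1 - theta 1) * c.
Hypothesis eta_c : l%:R * eta <= c.
Hypothesis split_index : forall k, (M < k)%N -> theta k * 2 <= eta /\
  exists2 i0, (i0 < l)%N &
    (forall i s t, (i < i0)%N -> theta k * l1norm s t (x i) <= eta) /\
    (forall i, (i0 < i < l)%N -> (k <= n i)%N).

Let K : nat := (\prod_(0 <= i < l) n i)%N.
Let w i : nat := (K %/ n i)%N.
Let G t : nat := (\sum_(0 <= i < l) w i * g i t)%N.
(* The norm of a block of unit vectors whose (fractional) length is the mass
   G t - G s, in units of 1/K, of [s, t): averaging over the offset u makes the
   mass additive while each term sees only whole unit vectors. *)
Let A s t : R := K%:R^-1 *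
  \sum_(0 <= u < K) N (ones R ((G s + u) %/ K) ((G t + u) %/ K)).
Let C t : nat := (\sum_(0 <= i < l) (b i < t))%N.
Let P s t : R := A s t + delta + c * (C t - C s)%:R.
Let X := \sum_(0 <= i < l) x i.

Let delta_ge0 : 0 <= delta.
Proof.
have nl : 0 < (n 0%N)%:R :> R by rewrite ltr0n n0.
by rewrite -(pmulr_lge0 _ nl); exact: le_trans ler01 (delta_n l0).
Qed.

Let c_ge0 : 0 <= c.
Proof.
have t1 : 0 < 1 - theta 1 by rewrite subr_gt0; case/andP: (@theta01 1%N isT).
by rewrite -(pmulr_rge0 _ t1); apply: le_trans delta_M; rewrite mulr_ge0.
Qed.

Let K0 : (0 < K)%N.
Proof.
rewrite /K big_nat; elim/big_rec: _ => // i p /andP[_ /n0 ni] p0.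
by rewrite muln_gt0 ni.
Qed.

Let KR0 : 0 < K%:R :> R. Proof. by rewrite ltr0n. Qed.

Let wn i : (i < l)%N -> (w i * n i = K)%N.
Proof.
move=> il; rewrite /w divnK// /K (bigD1_seq i) ?mem_index_iota ?iota_uniq//=.
exact: dvdn_mulr.
Qed.

Let mG : {homo G : s t / (s <= t)%N}.
Proof.
move=> s t st; rewrite /G big_nat [leqRHS]big_nat; apply: leq_sum => i /andP[_ il].
by rewrite leq_mul2l mg ?orbT.
Qed.

Let Gub t : (G t <= l * K)%N.
Proof.
rewrite /G big_nat; apply: (@leq_trans (\sum_(0 <= i < l) K)%N).
  rewrite [leqRHS]big_nat; apply: leq_sum => i /andP[_ il].
  by rewrite -(wn il) leq_mul2l gn ?orbT.
by rewrite sum_nat_const_nat subn0.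
Qed.

Let G_ge i s t : (i < l)%N -> (s <= t)%N -> (G s + w i * (g i t - g i s) <= G t)%N.
Proof.
move=> il st.
suff : (w i * (g i t - g i s) <= G t - G s)%N by have := mG st; lia.
have <- : (\sum_(0 <= j < l) w j * (g j t - g j s) = G t - G s)%N.
  rewrite /G !big_nat -sumnB; last by move=> j /andP[_ jl]; rewrite leq_mul2l mg ?orbT.
  by apply: eq_bigr => j _; rewrite mulnBr.
rewrite [leqRHS](bigD1_seq i) ?mem_index_iota ?iota_uniq//=.
exact: leq_addr.
Qed.

Let mC : {homo C : s t / (s <= t)%N}.
Proof.
move=> s t st; apply: leq_sum => i _; case: (ltnP (b i) s) => // bs.
by rewrite (leq_trans bs st).
Qed.

Let ones_ge p q : (p < q)%N -> 1 <= N (ones R p q).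
Proof.
move=> pq; apply: le_trans (coef_le_tnorm theta01 _ p).
by rewrite coef_ones leqnn pq normr1.
Qed.

Let A_ge0 s t : 0 <= A s t.
Proof.
by rewrite mulr_ge0 ?invr_ge0// sumr_ge0// => u _; exact: tnorm_ge0.
Qed.

Let A_ge i s t : (i < l)%N -> (s <= t)%N ->
  (g i t - g i s)%:R / (n i)%:R <= A s t.
Proof.
move=> il st; have ni : 0 < (n i)%:R :> R by rewrite ltr0n n0.
have wi : (0 < w i)%N by have := K0; rewrite -(wn il) muln_gt0 => /andP[].
set m := (w i * (g i t - g i s))%N.
have mK : (m <= K)%N.
  by rewrite -(wn il) leq_mul2l; apply/orP; right; have := gn t il; lia.
have -> : (g i t - g i s)%:R / (n i)%:R = K%:R^-1 * m%:R :> R.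
  have wR : (w i)%:R != 0 :> R by rewrite pnatr_eq0 -lt0n.
  rewrite /m -(wn il) !natrM; field.
  by rewrite wR (gt_eqF ni).
rewrite ler_pM2l ?invr_gt0//.
have {1}-> : m = (\sum_(0 <= u < K) ((G s + m + u) %/ K - (G s + u) %/ K))%N.
  rewrite sumnB; last by move=> u _; apply: leq_div2r; lia.
  by rewrite !sum_divn_shift//; lia.
rewrite natr_sum; apply: ler_sum => u _.
have [pq|pq] := ltnP ((G s + u) %/ K) ((G t + u) %/ K).
  apply: le_trans (ones_ge pq); rewrite lern1 leq_subLR.
  apply: (@leq_trans ((G s + K + u) %/ K)); first by apply: leq_div2r; lia.
  by rewrite addnAC divnDr ?dvdnn// divnn K0.
apply: le_trans (tnorm_ge0 theta01 _); rewrite lern0 subn_eq0.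
apply: leq_trans pq; apply: leq_div2r; have := G_ge il st; lia.
Qed.

Let tnorm_cut_block i s t : (i < l)%N -> (s <= t)%N ->
  N (cut s t (x i)) <= A s t + delta.
Proof.
move=> il st; have ni : 0 < (n i)%:R :> R by rewrite ltr0n n0.
apply: le_trans (lerD (A_ge il st) (lexx _)).
rewrite -(ler_pM2r ni) mulrDl divfK ?gt_eqF//.
apply: le_trans (xg il st) _; rewrite -addn1 natrD lerD2l.
exact: delta_n.
Qed.

Let A_breakpoints k m (r : nat -> nat) : (0 < k)%N -> (m <= k)%N ->
  {homo r : i j / (i <= j)%N} ->
  theta k * \sum_(0 <= j < m) A (r j) (r j.+1) <= A (r 0%N) (r m).
Proof.
move=> k0 mk mr; rewrite -mulr_sumr mulrCA ler_pM2l ?invr_gt0//.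
rewrite exchange_big/= mulr_sumr; apply: ler_sum => u _.
pose q j := ((G (r j) + u) %/ K)%N.
have mq : {homo q : i j / (i <= j)%N}.
  by move=> i j ij; apply: leq_div2r; rewrite leq_add2r; apply/mG/mr.
have := tnorm_breakpoints theta01 (ones R (q 0%N) (q m)) k0 mk mq.
rewrite cut_ones//; apply: le_trans; rewrite big_nat [X in _ <= _ * X]big_nat.
by rewrite (eq_bigr _ (fun j jm => congr1 N (@cut_ones _ _ _ _ _ (mq _ _ _) (mq _ _ _))))//;
  case/andP: jm.
Qed.

Let one_block s t : (forall i, (i < l)%N -> ~~ (s < b i < t)%N) ->
  exists2 i, (i < l)%N & cut s t X = cut s t (x i).
Proof.
move=> sbt.
have [i0 i0l [lo hi]] := last_index_le s l0 mb.
exists i0 => //; apply/polyP => p; rewrite !coef_cut; case: ifP => // /andP[sp pt].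
rewrite /X coef_sum (bigD1_seq i0) ?mem_index_iota ?iota_uniq//=.
rewrite big_seq_cond big1 ?addr0// => i /andP[]; rewrite mem_index_iota => /andP[_ il] ii0.
apply/eqP; apply: contraT => /(sx il) /andP[bip pbi].
have [ij|ij|ij] := ltngtP i i0; last by rewrite ij eqxx in ii0.
- by have := lo _ ij; lia.
- by have := hi i; have := sbt _ il; rewrite ij il; lia.
Qed.

Let cut_no_cuts s t : (s <= t)%N -> (forall i, (i < l)%N -> ~~ (s < b i < t)%N) ->
  N (cut s t X) <= P s t.
Proof.
move=> st /one_block[i il ->]; apply: le_trans (tnorm_cut_block il st) _.
by rewrite lerDl mulr_ge0.
Qed.

Let P_breakpoints_small k m (r : nat -> nat) : (0 < k)%N -> (m <= k)%N -> (k <= M)%N ->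
  {homo r : i j / (i <= j)%N} -> (C (r 0%N) < C (r m))%N ->
  theta k * \sum_(0 <= j < m) P (r j) (r j.+1) <= P (r 0%N) (r m).
Proof.
move=> k0 mk kM mr Cr; set d : R := (C (r m) - C (r 0%N))%:R.
have -> : \sum_(0 <= j < m) P (r j) (r j.+1) =
    \sum_(0 <= j < m) A (r j) (r j.+1) + (delta *+ m + c * d).
  rewrite /P !big_split/= sumr_const_nat subn0 -addrA; congr (_ + (_ + _)).
  by rewrite -[LHS]mulr_sumr -natr_sum telescope_sumn// => p q pq; apply/mC/mr.
rewrite mulrDr /P -addrA; apply: lerD; first exact: A_breakpoints.
rewrite -/d mulrDr.
have d1 : 1 <= d by rewrite ler1n subn_gt0.
have tk0 := theta_ge0 theta01 k0; have tk1 := theta_le1 theta01 k0.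
have t11 : theta k <= theta 1 by exact: theta_noninc.
have t1 := theta_le1 theta01 (ltnSn 0).
have md : delta *+ m <= (1 - theta 1) * c.
  by apply: le_trans delta_M; rewrite -[leLHS]mulr_natl ler_wpM2r// ler_nat (leq_trans mk).
have h1 : theta k * (delta *+ m) <= (1 - theta 1) * c * d.
  apply: (@le_trans _ _ ((1 - theta 1) * c)).
    by apply: le_trans md; rewrite ler_piMl// mulrn_wge0.
  by rewrite ler_peMr// mulr_ge0// subr_ge0.
have h2 : theta k * (c * d) <= theta 1 * (c * d).
  by rewrite ler_wpM2r// mulr_ge0// (le_trans ler01).
apply: le_trans (lerD h1 h2) _; rewrite -mulrA -mulrDl subrK mul1r.
by rewrite lerDr.
Qed.

Let P_breakpoints_large k m (r : nat -> nat) : (0 < k)%N -> (m <= k)%N -> (M < k)%N ->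
  {homo r : i j / (i <= j)%N} -> (C (r 0%N) < C (r m))%N ->
  theta k * \sum_(0 <= j < m) N (cut (r j) (r j.+1) X) <= P (r 0%N) (r m).
Proof.
move=> k0 mk Mk mr Cr; have [tk2 [i0 i0l [small many]]] := split_index Mk.
have tk0 := theta_ge0 theta01 k0.
have eta0 : 0 <= eta by apply: le_trans tk2; rewrite mulr_ge0.
pose e i := theta k * \sum_(0 <= j < m) N (cut (r j) (r j.+1) (x i)).
apply: (@le_trans _ _ (\sum_(0 <= i < l) e i)).
  rewrite /e -mulr_sumr ler_wpM2l// exchange_big/=; apply: ler_sum => j _.
  by rewrite /X linear_sum; exact: tnorm_sum.
have r0m := mr _ _ (leq0n m).
have e_i0 : e i0 <= A (r 0%N) (r m) + delta.
  apply: le_trans (tnorm_cut_block i0l r0m); exact: tnorm_breakpoints.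
have e_i i : (i < l)%N -> i != i0 -> e i <= eta.
  move=> il; case: ltngtP => // [ii0|ii0] _.
    apply: le_trans (small i (r 0%N) (r m) ii0).
    rewrite -l1norm_breakpoints// ler_wpM2l//; apply: ler_sum => j _.
    by apply: tnorm_cut_le_l1norm => //; apply: mr.
  have ni : 0 < (n i)%:R :> R by rewrite ltr0n n0.
  apply: le_trans tk2; rewrite ler_wpM2l// -(ler_pM2r ni) mulr_suml.
  apply: (@le_trans _ _ (\sum_(0 <= j < m) (g i (r j.+1) - g i (r j)).+1%:R)).
    by apply: ler_sum => j _; apply: xg => //; apply: mr.
  rewrite -natr_sum -natrM ler_nat.
  under eq_bigr do rewrite -addn1.
  rewrite big_split/= telescope_sumn; last by move=> p q pq; apply/mg/mr.
  rewrite sum_nat_const_nat subn0 muln1.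
  by have := gn (r m) il; have := many i; rewrite ii0 il => /(_ isT); lia.
apply: (@le_trans _ _ ((\sum_(0 <= i < l) eta) + (A (r 0%N) (r m) + delta))).
  rewrite (bigD1_seq i0) ?mem_index_iota ?iota_uniq//= addrC lerD//.
  rewrite [leRHS](bigD1_seq i0) ?mem_index_iota ?iota_uniq//=.
  apply: le_trans (_ : _ <= \sum_(0 <= i < l | i != i0) eta) _; last by rewrite lerDr.
  by rewrite big_nat_cond [leRHS]big_nat_cond; apply: ler_sum => i /andP[/andP[_ il]]; exact: e_i.
rewrite sumr_const_nat subn0 -mulr_natl addrC /P lerD2l.
apply: le_trans eta_c _; rewrite ler_peMr// ler1n subn_gt0//.
Qed.

Lemma tnorm_rapidly_increasing : N X <= N (ones R 0 l) + delta + c * l%:R.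
Proof.
have XE : X = cut 0 (b l) X.
  rewrite /X linear_sum big_nat [RHS]big_nat; apply: eq_bigr => i /andP[_ il].
  rewrite /= cut_full// => p /(sx il); have := mb il; lia.
apply: (@le_trans _ _ (P 0%N (b l))); last first.
  rewrite /P lerD//; last first.
    rewrite ler_wpM2l// ler_nat (leq_trans (leq_subr _ _))//.
    apply: (@leq_trans (\sum_(0 <= i < l) 1)%N).
      by apply: leq_sum => i _; case: (b i < b l)%N.
    by rewrite sum_nat_const_nat subn0 muln1.
  rewrite lerD2r /A ler_pdivrMl//.
  apply: (@le_trans _ _ (\sum_(0 <= u < K) N (ones R 0 l))); last first.
    by rewrite sumr_const_nat subn0 mulr_natl.
  rewrite big_nat [leRHS]big_nat; apply: ler_sum => u /andP[_ uK].
  have Gl : ((G (b l) + u) %/ K <= l)%N.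
    rewrite -ltnS ltn_divLR// mulSn; have := Gub (b l); lia.
  by rewrite -(@cut_ones _ 0 l _ _ (leq0n _) Gl); exact: tnorm_cut.
suff : N (cut 0 (b l) X) <= Num.min (P 0%N (b l)) (N (cut 0 (b l) X)).
  by rewrite -XE le_min => /andP[].
apply: (tnorm_cut_le theta01 (P := fun s t => Num.min (P s t) (N (cut s t X)))) => //.
- move=> s t st; rewrite le_min tnorm_ge0// andbT.
  by rewrite !addr_ge0// mulr_ge0.
- move=> s t p /andP[sp pt]; rewrite le_min coef_le_tnorm_cut ?sp// andbT.
  have [i il Xi] : exists2 i, (i < l)%N & cut p p.+1 X = cut p p.+1 (x i).
    by apply: one_block => i il; lia.
  have -> : X`_p = (x i)`_p.
    by have := congr1 (fun y : c00 R => y`_p) Xi; rewrite !coef_cut leqnn ltnSn.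
  apply: (@le_trans _ _ (A s t + delta)); last by rewrite lerDl mulr_ge0.
  apply: le_trans (tnorm_cut_block il _); last by lia.
  by apply: coef_le_tnorm_cut; rewrite ?sp.
- move=> k m r k0 mk mr; rewrite le_min; apply/andP; split; last first.
    apply: le_trans (tnorm_breakpoints theta01 X k0 mk mr).
    rewrite ler_wpM2l ?theta_ge0//; apply: ler_sum => j _.
    by rewrite ge_min lexx orbT.
  have [Cr|Cr] := ltnP (C (r 0%N)) (C (r m)).
    have [kM|Mk] := leqP k M.
      apply: le_trans (P_breakpoints_small k0 mk kM mr Cr).
      rewrite ler_wpM2l ?theta_ge0//; apply: ler_sum => j _.
      by rewrite ge_min lexx.
    apply: le_trans (P_breakpoints_large k0 mk Mk mr Cr).
    rewrite ler_wpM2l ?theta_ge0//; apply: ler_sum => j _.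
    by rewrite ge_min lexx orbT.
  apply: (@le_trans _ _ (N (cut (r 0%N) (r m) X))).
    apply: le_trans (tnorm_breakpoints theta01 X k0 mk mr).
    rewrite ler_wpM2l ?theta_ge0//; apply: ler_sum => j _.
    by rewrite ge_min lexx orbT.
  apply: cut_no_cuts; first exact: mr.
  move=> i il; apply/negP => /andP[rb br]; move: Cr; rewrite leqNgt => /negP; apply.
  rewrite /C (bigD1_seq i) ?mem_index_iota ?iota_uniq//=.
  rewrite [ltnRHS](bigD1_seq i) ?mem_index_iota ?iota_uniq//=.
  have -> : (b i < r 0%N)%N = false by apply/negbTE; rewrite -leqNgt ltnW.
  rewrite br add0n add1n ltnS; apply: leq_sum => j _.
  case: (ltnP (b j) (r 0%N)) => // bj.
  by rewrite (leq_trans bj) ?mr.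
Qed.

End RapidlyIncreasing.

Section Combinations.
Variables (R : realType) (u : nat -> c00 R).
Implicit Types p q : {poly R}.

Definition comb p : c00 R := \sum_(j < size p) p`_j *: u j.

Lemma comb_widen n p : (size p <= n)%N -> comb p = \sum_(j < n) p`_j *: u j.
Proof.
move=> pn; rewrite /comb -(big_mkord xpredT (fun j => p`_j *: u j)).
rewrite -(big_mkord xpredT (fun j => p`_j *: u j)) [RHS](@big_cat_nat _ _ _ (size p))//=.
have -> : \sum_(size p <= j < n) p`_j *: u j = 0.
  by rewrite big_nat big1// => j /andP[pj _]; rewrite nth_default ?scale0r.
by rewrite addr0.
Qed.

Lemma comb_linear : linear comb.
Proof.
move=> c p q; pose n := maxn (size (c *: p + q)) (maxn (size p) (size q)).
rewrite !(@comb_widen n); [|lia..].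
rewrite scaler_sumr -big_split/=; apply: eq_bigr => j _.
by rewrite coefD coefZ scalerDl scalerA.
Qed.

HB.instance Definition _ := GRing.isLinear.Build R {poly R} (c00 R) *:%R comb comb_linear.

Lemma combXn k : comb 'X^k = u k.
Proof.
rewrite /comb size_polyXn (bigD1 ord_max)//= coefXn eqxx scale1r big1 ?addr0//.
by move=> j jk; rewrite coefXn; case: eqP => [jE|_]; rewrite ?scale0r//;
  rewrite -val_eqE/= jE eqxx in jk.
Qed.

Hypothesis ub : block_seq u.

Definition block_start j := if j is i.+1 then size (u i) else 0%N.

Lemma block_start_supp j i : (u j)`_i != 0 -> (block_start j <= i < block_start j.+1)%N.
Proof.
move=> ui; apply/andP; split; last first.
  by rewrite ltnNge; apply: contra_neqN ui => /(nth_default 0).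
case: ub => u0 ubef; case: j ui => //= j ui.
have := ubef j j.+1 (ltnSn j) (size (u j)).-1 i; rewrite !in_supp ui.
rewrite -lead_coefE lead_coef_eq0 u0 => /(_ isT isT).
exact: leq_trans (leqSpred _).
Qed.

Lemma block_start_homo : {homo block_start : i j / (i <= j)%N}.
Proof.
apply: homo_leq => [//|s r t|i]; first exact: leq_trans.
have u0 : (u i)`_(size (u i)).-1 != 0 by rewrite -lead_coefE lead_coef_eq0; case: ub.
by have := block_start_supp u0; lia.
Qed.

Lemma comb_supp m n p : (forall j, p`_j != 0 -> (m <= j < n)%N) ->
  forall i, (comb p)`_i != 0 -> (block_start m <= i < block_start n)%N.
Proof.
move=> pmn i; rewrite /comb coef_sum => /eqP sn0.
have [j /eqP] : exists j : 'I_(size p), (p`_j *: u j)`_i <> 0.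
  by apply/existsNP => h; apply: sn0; rewrite big1.
rewrite coefZ mulf_eq0 negb_or => /andP[/pmn/andP[mj jn] /block_start_supp/andP[h1 h2]].
have := block_start_homo mj; have := block_start_homo jn; lia.
Qed.

End Combinations.

Section Existence.
Variables (R : realType) (theta : nat -> R) (X : completeNormedModType R).
Variable iota : {linear c00 R -> X}.
Hypothesis theta_weights : admissible_weights theta.
Hypothesis iota_norm : forall x, `|iota x| = tnorm theta x.
Hypothesis X_fbr : l1_fbr_in_every_block_subspace iota.
Local Notation N := (tnorm theta).

Let theta01 k : (0 < k)%N -> 0 < theta k < 1.
Proof. by case: theta_weights => + _ _; exact. Qed.

Lemma weights_small (e : R) : 0 < e -> exists K, forall k, (K <= k)%N -> theta k <= e.
Proof.
move=> e0; case: theta_weights => _ _ /cvgr0Pnorm_le/(_ e e0)[K _ Kth].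
by exists K => k Kk; apply: le_trans (ler_norm _) _; exact: Kth.
Qed.

Lemma l1norm_le_size s t (x : c00 R) : l1norm s t x <= l1norm 0 (size x) x.
Proof.
have [ts|st] := leqP t s; first by rewrite /l1norm big_geq// l1norm_ge0.
rewrite /l1norm (@le_trans _ _ (\sum_(0 <= i < maxn t (size x)) `|x`_i|))//.
  rewrite (@big_cat_nat _ _ _ s 0)//=; last by lia.
  rewrite [X in _ + X](@big_cat_nat _ _ _ t s)//=; [|lia..].
  by rewrite addrCA lerDl addr_ge0// sumr_ge0.
rewrite (@big_cat_nat _ _ _ (size x) 0)//=; last by lia.
rewrite gerDl big_nat big1// => i /andP[xi _].
by rewrite nth_default ?normr0.
Qed.

(* The equivalence to the l_1^n basis only serves to bound the norm below. *)
Lemma average_in_tail (u : nat -> c00 R) J n : block_seq u -> (0 < n)%N ->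
  exists (p : {poly R}) (g : nat -> nat),
  [/\ forall j, p`_j != 0 -> (J <= j)%N, 2^-1 <= N (comb u p),
      {homo g : i j / (i <= j)%N}, forall t, (g t <= n)%N
    & forall a b, (a <= b)%N ->
      N (cut a b (comb u p)) * n%:R <= (g b - g a).+1%:R].
Proof.
move=> [u0 ub] n0.
have ubJ : block_seq (fun i => u (J + i)%N).
  split=> [i|i j ij]; first exact: u0.
  by apply: ub; move: ij; rewrite !ltEnat/= ltn_add2l.
have [y [yb ycomb y1 yl1]] := X_fbr ubJ n0 (@ltr01 R).
have /choice[q yq] : forall j, exists q : {poly R},
    y j = comb u q /\ forall i, q`_i != 0 -> (J <= i)%N.
  move=> j; have [m [c ->]] := ycomb j.
  exists (\sum_(i < m) c i *: 'X^(J + i)); split.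
    by rewrite linear_sum; apply: eq_bigr => i _; rewrite linearZ/= combXn.
  move=> i; rewrite coef_sum => /eqP sn0; rewrite leqNgt; apply/negP => iJ; apply: sn0.
  by rewrite big1// => k _; rewrite coefZ coefXn ltn_eqF ?mulr0//; lia.
have yN j : N (y j) <= 1 by rewrite -iota_norm y1.
have [g [mg gn yg]] := tnorm_average theta01 n0 yb yN.
exists (n%:R^-1 *: \sum_(j < n) q j), g.
have -> : comb u (n%:R^-1 *: \sum_(j < n) q j) = n%:R^-1 *: \sum_(j < n) y j.
  rewrite linearZ linear_sum/=; congr (_ *: _); apply: eq_bigr => j _.
  by have [->] := yq j.
split => //.
  move=> j; rewrite coefZ coef_sum => /eqP sn0; rewrite leqNgt; apply/negP => iJ; apply: sn0.
  rewrite big1 ?mulr0// => k _; apply/eqP; apply: contraT => /(yq k).2.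
  by rewrite leqNgt iJ.
have nR : 0 < n%:R :> R by rewrite ltr0n.
have [A [B [A0 B0 AB AnB]]] := yl1.
have B1 : 1 <= B.
  pose j0 := Ordinal n0.
  have /andP[_] := AnB (fun j => (j == j0)%:R).
  rewrite (bigD1 j0)//= ?eqxx scale1r big1; last first.
    by move=> j /negPf ->; rewrite scale0r.
  rewrite addr0 y1 (bigD1 j0)//= ?eqxx normr1 big1; last first.
    by move=> j /negPf ->; rewrite normr0.
  by rewrite addr0 mulr1.
have A2 : A <= 2 by apply: le_trans AB; rewrite ler_peMr// ltW.
have /andP[+ _] := AnB (fun=> n%:R^-1).
rewrite sumr_const card_ord ger0_norm ?invr_ge0 ?ler0n//.
rewrite -[X in A^-1 * X]mulr_natl mulfV ?gt_eqF// mulr1 => AN.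
apply: (@le_trans _ _ A^-1); first by rewrite lef_pV2 ?posrE.
by rewrite -iota_norm linearZ linear_sum/= scaler_sumr.
Qed.

Lemma rapidly_increasing_exists (u : nat -> c00 R) l : block_seq u -> (0 < l)%N ->
  exists (J : nat -> nat) (p : nat -> {poly R}),
  [/\ {homo J : i j / (i <= j)%N},
      forall i j, (p i)`_j != 0 -> (J i <= j < J i.+1)%N,
      forall i, 2^-1 <= N (comb u (p i))
    & N (comb u (\sum_(0 <= i < l) p i)) <= 3 * N (ones R 0 l)].
Proof.
move=> ub l0; have lR : 0 < l%:R :> R by rewrite ltr0n.
have /andP[t1 t1'] := @theta01 1%N isT.
pose eta : R := (l%:R ^+ 2)^-1; pose c : R := l%:R^-1.
have eta0 : 0 < eta by rewrite invr_gt0 exprn_gt0.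
have [M Mth] := weights_small (divr_gt0 eta0 (ltr0n R 2)).
pose delta := (1 - theta 1) * c / M.+1%:R.
have c0 : 0 < c by rewrite invr_gt0.
have delta0 : 0 < delta by rewrite divr_gt0 ?mulr_gt0 ?subr_gt0 ?ltr0n.
have /choice[step stepP] : forall s : nat * nat, exists r : (nat * nat) * {poly R} * (nat -> nat),
    (0 < s.2)%N ->
    [/\ (s.1 <= r.1.1.1)%N /\ (s.2 <= r.1.1.2)%N,
        (forall j, r.1.2`_j != 0 -> (s.1 <= j < r.1.1.1)%N) /\ 2^-1 <= N (comb u r.1.2),
        {homo r.2 : i j / (i <= j)%N} /\ (forall t, (r.2 t <= s.2)%N),
        forall a b, (a <= b)%N ->
           N (cut a b (comb u r.1.2)) * s.2%:R <= (r.2 b - r.2 a).+1%:R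
      & forall k a b, (r.1.1.2 <= k)%N -> theta k * l1norm a b (comb u r.1.2) <= eta].
  move=> [J n] /=; have [->|n0] := posnP n; first by exists ((0%N, 0%N), 0, id).
  have [p [g [pJ p2 mg gn pg]]] := average_in_tail J ub n0.
  have l10 := l1norm_ge0 0 (size (comb u p)) (comb u p).
  have [K Kth] := weights_small (divr_gt0 eta0 (ltr_pwDr ltr01 l10)).
  exists ((maxn J (size p), maxn 1 (maxn n K)), p, g) => _ /=; split => //.
  - by rewrite leq_maxl; lia.
  - split=> // j pj; rewrite pJ//= leq_max; apply/orP; right.
    by rewrite ltnNge; apply: contra_neqN pj => /(nth_default 0).
  - move=> k a b Kk; have Kk' : (K <= k)%N by lia.
    apply: (@le_trans _ _ (theta k * (l1norm 0 (size (comb u p)) (comb u p) + 1))).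
      rewrite ler_wpM2l//; last by apply: le_trans (l1norm_le_size _ _ _) _; rewrite lerDl.
      by apply: ltW; have /andP[] : 0 < theta k < 1 by apply: theta01; lia.
    by rewrite -ler_pdivlMr ?Kth// ltr_pwDr.
pose n1 := (Num.bound (delta^-1)).+1.
pose st := fix st i := if i is i'.+1 then (step (st i')).1.1 else (0%N, n1).
have st0 i : (0 < (st i).2)%N.
  by elim: i => //= i IH; have [[_ h] _ _ _ _] := stepP _ IH; apply: leq_trans h.
pose J i := (st i).1; pose n i := (st i).2.
pose p i := (step (st i)).1.2; pose g i := (step (st i)).2.
have mJ : {homo J : i j / (i <= j)%N}.
  apply: homo_leq => [//|s r t|i]; first exact: leq_trans.
  by rewrite /J/=; have [[+ _] _ _ _ _] := stepP _ (st0 i).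
have mn : {homo n : i j / (i <= j)%N}.
  apply: homo_leq => [//|s r t|i]; first exact: leq_trans.
  by rewrite /n/=; have [[_ +] _ _ _ _] := stepP _ (st0 i).
have pJ i j : (p i)`_j != 0 -> (J i <= j < J i.+1)%N.
  by rewrite /J/=; have [_ [+ _] _ _ _] := stepP _ (st0 i); exact.
exists J, p; split => //.
  by move=> i; have [_ [_ +] _ _ _] := stepP _ (st0 i).
rewrite linear_sum /=.
have n1d : 1 <= delta * n1%:R.
  rewrite mulrC -ler_pdivrMr// mul1r ltW//; apply: lt_le_trans (archi_boundP _) _.
    by rewrite invr_ge0 ltW.
  by rewrite ler_nat.
have := @tnorm_rapidly_increasing R theta theta01 _ l (fun i => comb u (p i))
  (fun i => block_start u (J i)) n g delta c eta M.
have -> : c * l%:R = 1 by rewrite mulVf ?gt_eqF.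
have ones1 : 1 <= N (ones R 0 l).
  apply: le_trans (coef_le_tnorm theta01 _ 0); by rewrite coef_ones l0 normr1.
move=> h; apply: le_trans (h _ _ _ _ _ _ _ _ _ _ _ _) _ => //.
- by case: theta_weights.
- by move=> i j ij; apply: block_start_homo => //; exact: mJ.
- move=> i q il; apply: comb_supp => //; exact: pJ.
- by move=> i il; exact: st0.
- by move=> i _; have [_ _ [+ _] _ _] := stepP _ (st0 i).
- by move=> i t _; have [_ _ [_ +] _ _] := stepP _ (st0 i); exact.
- by move=> i s t _ st'; have [_ _ _ + _] := stepP _ (st0 i); exact.
- move=> i _; apply: le_trans n1d _; rewrite ler_pM2l// ler_nat.
  exact: (mn 0%N i).
- rewrite /delta mulrA ler_pdivrMr ?ltr0n// mulrC ler_wpM2l ?ler_nat//.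
  by rewrite mulr_ge0 ?subr_ge0 ?ltW.
- by rewrite /eta /c expr2 invfM mulrA mulfV ?gt_eqF// mul1r.
- move=> k Mk; split; first by rewrite -ler_pdivlMr ?Mth// ltnW.
  have [i0 i0l [lo hi]] := last_index_le k l0 mn.
  exists i0 => //; split=> [i s t /lo ii0|i /hi/ltnW//].
  by have [_ _ _ _ +] := stepP _ (st0 i); exact.
- have delta1 : delta <= 1.
    rewrite /delta -mulrA; apply: mulr_ile1.
    + by rewrite subr_ge0 ltW.
    + by rewrite divr_ge0 ?ltW// ltr0n.
    + by rewrite gerBl ltW.
    + rewrite /c -invfM invf_le1 ?mulr_gt0 ?ltr0n// -natrM ler1n; lia.
  by lra.
Qed.

End Existence.

Lemma tnorm_ones_le (R : realType) (theta theta' : nat -> R)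
    (X : completeNormedModType R) (iota : {linear c00 R -> X})
    (u u' : nat -> c00 R) (D : R) :
  admissible_weights theta -> admissible_weights theta' ->
  (forall x, `|iota x| = tnorm theta x) ->
  l1_fbr_in_every_block_subspace iota ->
  block_seq u -> block_seq u' -> 0 < D ->
  (forall p, tnorm theta (comb u p) <= D * tnorm theta' (comb u' p)) ->
  (forall p, tnorm theta' (comb u' p) <= D * tnorm theta (comb u p)) ->
  forall l, (0 < l)%N ->
    tnorm theta' (ones R 0 l) <= 6 * D ^+ 2 * tnorm theta (ones R 0 l).
Proof.
move=> W W' iN fbr ub u'b D0 uu' u'u l l0.
have [J [p [mJ pJ p2 pl]]] := rapidly_increasing_exists W iN fbr ub l0.
have theta'01 k : (0 < k)%N -> 0 < theta' k < 1 by case: W' => + _ _; exact.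
have D2 : 0 < (2 * D)^-1 by rewrite invr_gt0 mulr_gt0.
have := @tnorm_blocks_ge R theta' theta'01 l (fun i => comb u' (p i))
  (fun i => block_start u' (J i)) (2 * D)^-1.
move=> /(_ _ _ D2) dom; rewrite -(ler_pM2l D2).
apply: le_trans (dom _ _ _) _.
- by move=> i j ij; apply: block_start_homo => //; exact: mJ.
- by move=> i q il; apply: comb_supp => //; exact: pJ.
- move=> i il; rewrite invfM ler_pdivrMr// mulrC.
  exact: le_trans (p2 i) (uu' _).
have -> : \sum_(0 <= i < l) comb u' (p i) = comb u' (\sum_(0 <= i < l) p i).
  by rewrite linear_sum.
apply: le_trans (u'u _) _.
rewrite -ler_pdivlMl//; apply: le_trans pl _.
set T := tnorm theta _.
suff -> : D^-1 * ((2 * D)^-1 * (6 * D ^+ 2 * T)) = 3 * T by [].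
by field; rewrite gt_eqF.
Qed.

Section Subspaces.
Variables (R : realType) (X : normedModType R).
Implicit Types (Y : set X) (phi : X -> R).

Definition submodule Y := Y 0 /\ forall (a : R) x y, Y x -> Y y -> Y (a *: x + y).

Lemma subspace_submodule Y : subspace_of Y -> submodule Y.
Proof.
case=> -[Y0 YD] _ _; split; first by have := Y0; rewrite inE.
by move=> a x y Yx Yy; have := YD a x y; rewrite !inE; exact.
Qed.

Lemma submodule_sum Y (I : Type) (r : seq I) (c : I -> R) (y : I -> X) :
  submodule Y -> (forall i, Y (y i)) -> Y (\sum_(i <- r) c i *: y i).
Proof.
by move=> [Y0 YD] Yy; elim/big_rec: _ => // i x _ Yx; exact: YD.
Qed.

Definition functional_on Y phi :=
  forall (a : R) x y, Y x -> Y y -> phi (a *: x + y) = a * phi x + phi y.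

Lemma functional_on0 Y phi : submodule Y -> functional_on Y phi -> phi 0 = 0.
Proof.
move=> [Y0 _] /(_ 1 0 0 Y0 Y0); rewrite scaler0 addr0 mul1r => /eqP.
by rewrite -subr_eq subrr eq_sym => /eqP.
Qed.

Lemma submodule_kernel Y phi : submodule Y -> functional_on Y phi ->
  submodule (Y `&` [set x | phi x = 0]).
Proof.
move=> sY lphi; have phi0 := functional_on0 sY lphi.
case: sY => Y0 YD; split; first by [].
move=> a x y [Yx /= px] [Yy /= py]; split; first exact: YD.
by rewrite /= lphi// px py mulr0 addr0.
Qed.

Lemma kernel_infinite_dimensional Y phi : submodule Y -> functional_on Y phi ->
  ~ finite_dimensional Y -> ~ finite_dimensional (Y `&` [set x | phi x = 0]).
Proof.
move=> sY lphi nfY [n [v vY]]; apply: nfY.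
have [Yker|] := pselect (forall x, Y x -> phi x = 0).
  by exists n, v => x Yx; apply: vY; split => //; exact: Yker.
move=> /existsNP[x0 /not_implyP[Yx0 /eqP px0]].
exists n.+1, (fun i => if unlift ord0 i is Some j then v j else x0) => x Yx.
have [|a xa] := vY (- (phi x / phi x0) *: x0 + x).
  split; first by case: sY => _; exact.
  by rewrite /= lphi// mulNr divfK// addNr.
exists (fun i => if unlift ord0 i is Some j then a j else phi x / phi x0).
rewrite big_ord_recl unlift_none; under eq_bigr do rewrite liftK.
by rewrite -xa scaleNr addrA subrr add0r.
Qed.

Lemma common_kernel_neq0 Y (phi psi : nat -> X -> R) m : submodule Y ->
  (forall i, functional_on Y (phi i)) -> (forall i, functional_on Y (psi i)) ->
  ~ finite_dimensional Y ->
  exists x, [/\ Y x, x != 0 & forall i, (i < m)%N -> phi i x = 0 /\ psi i x = 0].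
Proof.
move=> sY lphi lpsi nfY.
pose Z k := Y `&` [set x | forall i, (i < k)%N -> phi i x = 0 /\ psi i x = 0].
have subf Z' phi' : Z' `<=` Y -> functional_on Y phi' -> functional_on Z' phi'.
  by move=> Z'Y lp a x y /Z'Y ? /Z'Y ?; exact: lp.
have [sZ nfZ] : submodule (Z m) /\ ~ finite_dimensional (Z m).
  elim: m => [|m [sZ nfZ]].
    suff -> : Z 0%N = Y by [].
    by apply/seteqP; split => [x []|x Yx]//; split.
  have lphiZ : functional_on (Z m) (phi m) by apply: subf => // x [].
  have sZ1 := submodule_kernel sZ lphiZ.
  have nfZ1 := kernel_infinite_dimensional sZ lphiZ nfZ.
  have lpsiZ : functional_on (Z m `&` [set x | phi m x = 0]) (psi m).
    by apply: subf => // x [[]].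
  have sZ2 := submodule_kernel sZ1 lpsiZ.
  have nfZ2 := kernel_infinite_dimensional sZ1 lpsiZ nfZ1.
  suff -> : Z m.+1 = Z m `&` [set x | phi m x = 0] `&` [set x | psi m x = 0] by [].
  apply/seteqP; split => x.
    move=> [Yx zx]; have [h1 h2] := zx m (ltnSn m); split => //; split => //.
    by split => // i im; apply: zx; exact: ltnW.
  move=> [[[Yx zx] /= h1] /= h2]; split => // i /=.
  by rewrite ltnS leq_eqVlt => /orP[/eqP->//|]; exact: zx.
have [x] : exists x, Z m x /\ x <> 0.
  apply: contrapT => Z0; apply: nfZ; exists 0%N, (fun=> 0) => x Zx.
  exists (fun=> 0); rewrite big_ord0; apply/eqP; apply: contraT => /eqP x0.
  by case: Z0; exists x.
by move=> [[Yx zx] /eqP x0]; exists x.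
Qed.

End Subspaces.

Section BoundedOn.
Variables (R : realType) (X X' : normedModType R) (Y : set X) (f : X -> X').
Hypothesis sY : submodule Y.
Hypothesis lf : linear_on Y f.

Lemma linear_on0 : f 0 = 0.
Proof.
have := lf 1 sY.1 sY.1; rewrite scaler0 addr0 scale1r => /eqP.
by rewrite -subr_eq subrr eq_sym => /eqP.
Qed.

Lemma linear_on_sum n (c : 'I_n -> R) (y : 'I_n -> X) : (forall i, Y (y i)) ->
  f (\sum_(i < n) c i *: y i) = \sum_(i < n) c i *: f (y i).
Proof.
move=> Yy; elim: n c y Yy => [|n IH] c y Yy; first by rewrite !big_ord0 linear_on0.
rewrite !big_ord_recl lf ?IH//.
exact: submodule_sum.
Qed.

Lemma linear_on_bounded : {within Y, continuous f} ->
  exists2 B, 0 < B & forall x, Y x -> `|f x| <= B * `|x|.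
Proof.
move=> /subspace_continuousP/(_ 0 sY.1) cf0.
have : f @ within Y (nbhs (0 : X)) --> (0 : X').
  by rewrite -[X in _ --> X]linear_on0; exact: cf0.
move=> /cvgr0Pnorm_lt/(_ 1 ltr01).
rewrite near_withinE => /nbhs_normP[d /= d0 df].
exists (2 / d); first by rewrite divr_gt0.
move=> x Yx; have [->|x0] := eqVneq x 0; first by rewrite linear_on0 !normr0 mulr0.
have nx : 0 < `|x| by rewrite normr_gt0.
pose a := d / 2 / `|x|; have a0 : 0 < a by rewrite !divr_gt0.
have fZ : f (a *: x) = a *: f x.
  by have := lf a Yx sY.1; rewrite linear_on0 !addr0.
have Yax : Y (a *: x) by have := sY.2 a _ _ Yx sY.1; rewrite addr0.
have : `|f (a *: x)| < 1.
  apply: df => //; rewrite /ball_ /= sub0r normrN normrZ gtr0_norm// divfK ?gt_eqF//.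
  by rewrite ltr_pdivrMr// ltr_pMr// ltr1n.
rewrite fZ normrZ gtr0_norm// -ltr_pdivlMl// mulr1 => /ltW/le_trans; apply.
by rewrite le_eqVlt; apply/orP; left; apply/eqP; rewrite /a; field; rewrite !gt_eqF.
Qed.

End BoundedOn.

Section Coordinates.
Variables (R : realType) (theta : nat -> R) (X : completeNormedModType R).
Variable iota : {linear c00 R -> X}.
Hypothesis theta01 : forall k, (0 < k)%N -> 0 < theta k < 1.
Hypothesis iota_norm : forall x, `|iota x| = tnorm theta x.
Hypothesis iota_dense : dense (range iota).
Local Notation N := (tnorm theta).

Lemma dense_approx y (e : R) : 0 < e -> exists z, `|y - iota z| < e.
Proof.
move=> e0; have [||w [yw [z _ zw]]] := iota_dense (O := ball y e).
- by exists y; exact: ballxx.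
- exact: ball_open.
- by exists z; move: yw; rewrite zw -ball_normE.
Qed.

(* The continuous extension to X of the i-th coordinate functional of c00. *)
Definition coord i (y : X) : R := sup [set z`_i - `|y - iota z| | z in [set: c00 R]].

Lemma coord_approx i y (z : c00 R) : `|coord i y - z`_i| <= `|y - iota z|.
Proof.
have ub : ubound [set z'`_i - `|y - iota z'| | z' in [set: c00 R]] (z`_i + `|y - iota z|).
  move=> _ [z' _ <-]; rewrite lerBlDr -addrA -lerBlDl.
  apply: le_trans (ler_norm _) _; rewrite -coefB.
  apply: le_trans (coef_le_tnorm theta01 _ _) _; rewrite -iota_norm linearB/=.
  rewrite addrC [X in _ <= X + _]distrC.
  by rewrite -(subrKA y); exact: ler_normD.
rewrite ler_distl; apply/andP; split.
  by apply: ub_le_sup; [exists (z`_i + `|y - iota z|)|exists z].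
by apply: ge_sup => //; exists (z`_i - `|y - iota z|), z.
Qed.

Lemma coord_linear i (a : R) x y : coord i (a *: x + y) = a * coord i x + coord i y.
Proof.
apply/eqP; rewrite -subr_eq0 -normr_le0 leNgt; apply/negP => d0.
set d := `|_| in d0.
have a1 : 0 < `|a| + 1 by rewrite ltr_wpDl.
pose e := d / (4 * (`|a| + 1)).
have e0 : 0 < e by rewrite divr_gt0// mulr_gt0.
have [zx zxe] := dense_approx x e0; have [zy zye] := dense_approx y e0.
have hx := coord_approx i x zx; have hy := coord_approx i y zy.
have := coord_approx i (a *: x + y) (a *: zx + zy).
have -> : a *: x + y - iota (a *: zx + zy) = a *: (x - iota zx) + (y - iota zy).
  by rewrite linearP scalerBr addrACA -opprD.
rewrite coefD coefZ => hxy.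
have {hxy} hxy := le_trans hxy (ler_normD _ _); rewrite normrZ in hxy.
have dE : d = 4 * (`|a| * e + e) by rewrite /e; field; rewrite gt_eqF.
have ha : `|a| * `|x - iota zx| <= `|a| * e by rewrite ler_wpM2l// ltW.
have ha' : `|a * (coord i x - zx`_i)| <= `|a| * e.
  by rewrite normrM ler_wpM2l// ltW// (le_lt_trans hx).
have : d <= `|coord i (a *: x + y) - (a * zx`_i + zy`_i)|
    + (`|a * (coord i x - zx`_i)| + `|coord i y - zy`_i|).
  rewrite /d; apply: le_trans (lerD (lexx _) (ler_normD _ _)).
  apply: le_trans (ler_normB _ _); rewrite le_eqVlt; apply/orP; left.
  by apply/eqP; congr `|_|; ring.
have ae0 : 0 <= `|a| * e by rewrite mulr_ge0// ltW.
move: dE hxy ha ha' ae0 hy; set q := `|a| * e; lra.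
Qed.

Lemma tail_approx y m (e : R) : 0 < e -> (forall i, (i < m)%N -> coord i y = 0) ->
  exists z : c00 R, (forall i, (i < m)%N -> z`_i = 0) /\ `|y - iota z| <= e.
Proof.
move=> e0 ym; have e'0 : 0 < e / m.+1%:R by rewrite divr_gt0.
have [z ze] := dense_approx y e'0; exists (z - cut 0 m z); split.
  by move=> i im; rewrite coefB coef_cut leq0n im subrr.
rewrite linearB/= opprB addrA [X in `|X|]addrAC.
apply: le_trans (ler_normD _ _) _.
have -> : e = e / m.+1%:R + m%:R * (e / m.+1%:R).
  by field; rewrite ?natr1 ?nat1r pnatr_eq0.
apply: lerD; first exact: ltW.
rewrite iota_norm; apply: le_trans (tnorm_cut_le_l1norm theta01 _ (leq0n m)) _.
rewrite mulr_natl -[X in _ *+ X]subn0 -sumr_const_nat /l1norm.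
rewrite big_nat [leRHS]big_nat; apply: ler_sum => i /andP[_ im].
have := coord_approx i y z; rewrite ym// sub0r normrN => /le_trans; apply.
exact: ltW.
Qed.

(* Small perturbation: each |p_i| is at most 2 / k times the norm of the
   combination, so the total error is at most sum_i 2^-(i + 2) of it. *)
Lemma comb_perturbation (u : nat -> c00 R) (y : nat -> X) (k : R) :
  block_seq u -> 0 < k -> (forall i, k / 2 <= N (u i)) ->
  (forall i, `|y i - iota (u i)| <= k / 2 ^+ (i + 3)) ->
  forall p : {poly R}, `|\sum_(i < size p) p`_i *: y i - iota (comb u p)| <= N (comb u p) / 2.
Proof.
move=> ub k0 ku yu p.
have pN i : (i < size p)%N -> `|p`_i| * (k / 2) <= N (comb u p).
  move=> ip; apply: (@le_trans _ _ (N (p`_i *: u i))).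
    by rewrite -iota_norm linearZ/= normrZ iota_norm ler_wpM2l.
  rewrite /comb -(big_mkord xpredT (fun j => p`_j *: u j)).
  rewrite -(@cut_sum_supported _ (block_start u) (size p) (fun j => p`_j *: u j) i)//.
  - exact: tnorm_cut.
  - exact: block_start_homo.
  - move=> j q jp; rewrite coefZ mulf_eq0 negb_or => /andP[_].
    exact: block_start_supp.
rewrite /comb linear_sum -sumrB.
apply: le_trans (ler_norm_sum _ _ _) _.
apply: (@le_trans _ _ (\sum_(i < size p) N (comb u p) * (2 ^+ (i + 2))^-1)).
  apply: ler_sum => i _; rewrite linearZ/= -scalerBr normrZ.
  apply: (@le_trans _ _ (`|p`_i| * (k / 2 ^+ (i + 3)))); first by rewrite ler_wpM2l.
  have -> : `|p`_i| * (k / 2 ^+ (i + 3)) = `|p`_i| * (k / 2) * (2 ^+ (i + 2))^-1.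
    by rewrite addnS exprS invfM !mulrA.
  by rewrite ler_wpM2r ?invr_ge0 ?exprn_ge0// pN.
rewrite -mulr_sumr ler_wpM2l ?tnorm_ge0//.
suff -> m : \sum_(i < m) (2 ^+ (i + 2))^-1 = 2^-1 - (2 ^+ (m + 1))^-1 :> R.
  by rewrite gerBl invr_ge0 exprn_ge0.
elim: m => [|m IH]; first by rewrite big_ord0 add0n expr1 subrr.
have e1 : 2 ^+ (m + 2) = 2 * 2 ^+ (m + 1) :> R by rewrite -exprS addnS.
have e2 : 2 ^+ (m.+1 + 1) = 2 * 2 ^+ (m + 1) :> R by rewrite -exprS addSn.
rewrite big_ord_recr/= IH e1 e2.
have : 2 ^+ (m + 1) != 0 :> R by rewrite expf_neq0.
by move: (2 ^+ (m + 1)) => q q0; field.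
Qed.

End Coordinates.

Section GlidingHump.
Variables (R : realType) (theta theta' : nat -> R) (X X' : completeNormedModType R).
Variables (iota : {linear c00 R -> X}) (iota' : {linear c00 R -> X'}).
Hypothesis theta01 : forall k, (0 < k)%N -> 0 < theta k < 1.
Hypothesis theta'01 : forall k, (0 < k)%N -> 0 < theta' k < 1.
Hypothesis iota_norm : forall x, `|iota x| = tnorm theta x.
Hypothesis iota'_norm : forall x, `|iota' x| = tnorm theta' x.
Hypothesis iota_dense : dense (range iota).
Hypothesis iota'_dense : dense (range iota').

Lemma block_seq_of_breaks (u : nat -> c00 R) (s : nat -> nat) :
  (forall i, u i != 0) -> {homo s : i j / (i <= j)%N} ->
  (forall i, (size (u i) <= s i.+1)%N) ->
  (forall i m, (m < s i)%N -> (u i)`_m = 0) -> block_seq u.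
Proof.
move=> u0 ms us su; split => // i j; rewrite ltEnat/= => ij p q.
rewrite !in_supp => pi qj; apply: (@leq_trans (s i.+1)).
  apply: leq_trans (us i); rewrite ltnNge; apply: contra_neqN pi.
  exact: (nth_default 0).
rewrite leqNgt; apply: contra_neqN qj => qs; apply: su.
by apply: leq_trans qs _; exact: ms.
Qed.

Lemma isomorphic_blocks (Y : set X) (Y' : set X') :
  subspace_of Y -> subspace_of Y' -> isomorphic Y Y' ->
  exists (u u' : nat -> c00 R) (D : R),
  [/\ block_seq u, block_seq u', 0 < D,
      forall p, tnorm theta (comb u p) <= D * tnorm theta' (comb u' p)
    & forall p, tnorm theta' (comb u' p) <= D * tnorm theta (comb u p)].
Proof.
move=> subY subY' [f [g [lf lg cf cg [YfY' Y'gY fK gK]]]].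
have sY := subspace_submodule subY; have sY' := subspace_submodule subY'.
have nfY : ~ finite_dimensional Y by case: subY.
have [B B0 fB] := linear_on_bounded sY lf cf.
have [B' B'0 gB'] := linear_on_bounded sY' lg cg.
pose k := Num.min 1 B'^-1.
have k0 : 0 < k by rewrite lt_min ltr01 invr_gt0.
have /choice[step stepP] : forall s : nat * nat, exists r : X * c00 R * c00 R,
    [/\ Y r.1.1, `|r.1.1| = 1,
        (forall m, (m < s.1)%N -> r.1.2`_m = 0) /\ (forall m, (m < s.1)%N -> r.2`_m = 0),
        `|r.1.1 - iota r.1.2| <= k / 2 ^+ (s.2 + 3)
      & `|f r.1.1 - iota' r.2| <= k / 2 ^+ (s.2 + 3)].
  move=> [s i] /=.
  have lc j : functional_on Y (coord iota j).
    by move=> a x y _ _; exact: (coord_linear theta01 iota_norm iota_dense).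
  have lc' j : functional_on Y (coord iota' j \o f).
    by move=> a x y Yx Yy /=; rewrite lf// (coord_linear theta'01 iota'_norm iota'_dense).
  have [x [Yx x0 cx]] := common_kernel_neq0 s sY lc lc' nfY.
  have nx : `|x| != 0 by rewrite normr_eq0.
  pose y := `|x|^-1 *: x.
  have Yy : Y y by have := sY.2 `|x|^-1 _ _ Yx sY.1; rewrite addr0.
  have cy j : (j < s)%N -> coord iota j y = 0.
    move=> /cx[cx0 _]; have := lc j `|x|^-1 _ _ Yx sY.1.
    by rewrite addr0 cx0 mulr0 add0r (functional_on0 sY (lc j)).
  have cy' j : (j < s)%N -> coord iota' j (f y) = 0.
    move=> /cx[_ cx0]; have := lc' j `|x|^-1 _ _ Yx sY.1.
    by rewrite addr0 cx0 mulr0 add0r (functional_on0 sY (lc' j)).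
  have e0 : 0 < k / 2 ^+ (i + 3) by rewrite divr_gt0// exprn_gt0.
  have [u [us yu]] := tail_approx theta01 iota_norm iota_dense e0 cy.
  have [u' [u's yu']] := tail_approx theta'01 iota'_norm iota'_dense e0 cy'.
  exists (y, u, u'); split => //=.
  by rewrite normrZ normfV normr_id mulVf.
pose st := fix st i := if i is i'.+1 then
  let r := step (st i', i') in maxn (st i') (maxn (size r.1.2) (size r.2)) else 0%N.
pose r i := step (st i, i); pose y i := (r i).1.1.
pose u i := (r i).1.2; pose u' i := (r i).2.
have mst : {homo st : i j / (i <= j)%N}.
  by apply: homo_leq => [//|? ? ?|i]; [exact: leq_trans|rewrite /= leq_maxl].
have ek i : k / 2 ^+ (i + 3) <= k / 2.
  rewrite ler_pM2l// lef_pV2 ?posrE ?exprn_gt0//.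
  by rewrite -[leLHS]expr1 ler_eXn2l// ?ltr1n//; lia.
have half (V : normedModType R) (v w : V) i : k <= `|v| ->
    `|v - w| <= k / 2 ^+ (i + 3) -> k / 2 <= `|w|.
  move=> kv /le_trans/(_ (ek i)) vw.
  have := ler_normD (v - w) w; rewrite subrK; lra.
have ku i : k / 2 <= tnorm theta (u i).
  have [_ y1 _ yu _] := stepP (st i, i); rewrite -iota_norm.
  by apply: half yu; rewrite y1 ge_min lexx.
have ku' i : k / 2 <= tnorm theta' (u' i).
  have [Yy y1 _ _ yu'] := stepP (st i, i); rewrite -iota'_norm.
  apply: half yu'; apply: (@le_trans _ _ B'^-1); first by rewrite ge_min lexx orbT.
  rewrite -[leLHS]mulr1 ler_pdivrMl// -[leLHS]y1 -[X in `|X| <= _](fK _ Yy).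
  by apply: gB'; exact: YfY'.
have neq0 (t : nat -> R) (z : c00 R) : (forall k, (0 < k)%N -> 0 < t k < 1) ->
    k / 2 <= tnorm t z -> z != 0.
  move=> t01; apply: contraTneq => ->; rewrite tnorm0// -ltNge.
  by rewrite divr_gt0.
have ub : block_seq u.
  apply: (@block_seq_of_breaks u st) => //.
  - by move=> i; exact: neq0 (ku i).
  - by move=> i /=; rewrite !leq_max leqnn orbT.
  - by move=> i m; have [_ _ [+ _] _ _] := stepP (st i, i); exact.
have u'b : block_seq u'.
  apply: (@block_seq_of_breaks u' st) => //.
  - by move=> i; exact: neq0 (ku' i).
  - by move=> i /=; rewrite !leq_max leqnn !orbT.
  - by move=> i m; have [_ _ [_ +] _ _] := stepP (st i, i); exact.
have Yy i : Y (y i) by have [] := stepP (st i, i).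
have pert := comb_perturbation theta01 iota_norm ub k0 ku (y := y).
have pert' := comb_perturbation theta'01 iota'_norm u'b k0 ku' (y := f \o y).
have {}pert p := pert (fun i => let: And5 _ _ _ h _ := stepP (st i, i) in h) p.
have {}pert' p := pert' (fun i => let: And5 _ _ _ _ h := stepP (st i, i) in h) p.
have dist (V : normedModType R) (v w : V) : `|v - w| <= `|w| / 2 ->
    `|w| <= 2 * `|v| /\ `|v| <= 3 / 2 * `|w|.
  move=> vw; have := ler_normD (v - w) w; have := ler_normB v (v - w).
  by rewrite subrK subKr; split; lra.
pose D := 3 * (B + B').
have D0 : 0 < D by rewrite mulr_gt0// addr_gt0.
have both p : tnorm theta (comb u p) <= D * tnorm theta' (comb u' p) /\
    tnorm theta' (comb u' p) <= D * tnorm theta (comb u p).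
  have := pert p; have := pert' p; rewrite -iota_norm -iota'_norm.
  set v := \sum_(i < size p) p`_i *: y i; set v' := \sum_(i < size p) _.
  move=> /dist[w'v v'w] /dist[wv vw].
  have Yv : Y v by apply: submodule_sum.
  have fv : f v = v' by rewrite /v (linear_on_sum sY lf).
  have h1 := fB _ Yv; have h2 := gB' _ (YfY' _ Yv).
  rewrite fK// in h2; rewrite fv in h1 h2.
  split; rewrite /D.
    apply: le_trans wv _; apply: (@le_trans _ _ (2 * (B' * `|v'|))).
      by rewrite ler_wpM2l.
    apply: (@le_trans _ _ (2 * (B' * (3 / 2 * `|iota' (comb u' p)|)))).
      by rewrite !ler_wpM2l// ltW.
    have := mulr_ge0 (ltW B0) (normr_ge0 (iota' (comb u' p))).
    by have := normr_ge0 (iota' (comb u' p)); nra.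
  apply: le_trans w'v _; apply: (@le_trans _ _ (2 * (B * `|v|))).
    by rewrite ler_wpM2l.
  apply: (@le_trans _ _ (2 * (B * (3 / 2 * `|iota (comb u p)|)))).
    by rewrite !ler_wpM2l// ltW.
  have := mulr_ge0 (ltW B'0) (normr_ge0 (iota (comb u p))).
  by have := normr_ge0 (iota (comb u p)); nra.
by exists u, u', D; split => // p; case: (both p).
Qed.

End GlidingHump.

Theorem theorem4 (R : realType) (theta theta' : nat -> R)
    (X X' : completeNormedModType R)
    (iota : {linear c00 R -> X}) (iota' : {linear c00 R -> X'}) :
  admissible_weights theta ->
  admissible_weights theta' ->
  is_T_A_space theta iota ->
  is_T_A_space theta' iota' ->
  l1_fbr_in_every_block_subspace iota ->
  l1_fbr_in_every_block_subspace iota' ->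
  ~ totally_incomparable X X' ->
  exists2 C : R, 0 < C &
    forall l : nat, (0 < l)%N ->
      C^-1 <= lambda_ iota l / lambda_ iota' l <= C.
Proof.
move=> W W' [iN idense] [iN' idense'] fbr fbr' nincomp.
have theta01 k : (0 < k)%N -> 0 < theta k < 1 by case: W => + _ _; exact.
have theta'01 k : (0 < k)%N -> 0 < theta' k < 1 by case: W' => + _ _; exact.
have [Y [Y' [sY sY' isoYY']]] : exists (Y : set X) (Y' : set X'),
    [/\ subspace_of Y, subspace_of Y' & isomorphic Y Y'].
  apply: contrapT => no; apply: nincomp => Y Y' sY sY' iso.
  by apply: no; exists Y, Y'.
have [u [u' [D [ub u'b D0 uu' u'u]]]] :=
  isomorphic_blocks theta01 theta'01 iN iN' idense idense' sY sY' isoYY'.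
have C0 : 0 < 6 * D ^+ 2 by rewrite mulr_gt0// exprn_gt0.
exists (6 * D ^+ 2) => // l l0.
have lambdaE (t : nat -> R) (V : completeNormedModType R) (i : {linear c00 R -> V}) :
    (forall x, `|i x| = tnorm t x) -> lambda_ i l = tnorm t (ones R 0 l).
  by move=> iV; rewrite /lambda_ iV /ones big_mkord.
have ones_gt0 (t : nat -> R) : (forall k, (0 < k)%N -> 0 < t k < 1) ->
    0 < tnorm t (ones R 0 l).
  move=> t01; apply: lt_le_trans (coef_le_tnorm t01 _ 0).
  by rewrite coef_ones l0 normr1.
have L0 := ones_gt0 _ theta01; have L'0 := ones_gt0 _ theta'01.
rewrite (lambdaE theta)// (lambdaE theta')//.
rewrite ler_pdivlMr// ler_pdivrMr// ler_pdivrMl//; apply/andP; split.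
  exact: (tnorm_ones_le W W' iN fbr ub u'b D0 uu' u'u).
exact: (tnorm_ones_le W' W iN' fbr' u'b ub D0 u'u uu').
Qed.
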